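(* Let $p_{Y|X}$ (receiver channel) and $p_{W|X}$ (detector channel) be memoryless channels with common input alphabet $\mathcal{X}$, let $x_0\in\mathcal{X}$ be the innocent symbol, and let $p_{\tilde X}$ be a kernel density on $\mathcal{X}$ with $0<\chi^2(p_{\tilde W}\parallel p_{W|X=x_0})<\infty$, where $p_{\tilde W}(w)=\int_{\mathcal{X}}p_{\tilde X}(x)p_{W|X}(w|x)\,dx$. Let $n\ge1$, $\epsilon_{\rm det},\epsilon_{\rm dec}\in(0,1)$, $\xi=e^{-\frac12\mathsf{W}_0(4\epsilon_{\rm det}^2)}$. Suppose the transmitter uses the sparse signalling density $$p_X(x)=(1-\tau)\delta(x-x_0)+\tau p_{\tilde X}(x),\qquad \tau=\frac{2\xi\epsilon_{\rm det}}{\sqrt{n\,\chi^2(p_{\tilde W}\parallel p_{W|X=x_0})}}\in[0,1].$$ Then there exists a code with $M$ code words of length $n$ (from the ensemble of codes with i.i.d. $p_X$ letters), with average decoding error probability (over the receiver channel) not exceeding $\epsilon_{\rm dec}$ and probability of detection not exceeding $\epsilon_{\rm det}$, such that for any $0<\rho\le1$, $$\log_2M\ \ge\ \epsilon_{\rm det}\sqrt n\,L(\rho)+\frac1\rho\log_2\epsilon_{\rm dec},$$ where $$L(\rho)=\frac{2\xi}{\log2}\left(\frac{1+\rho}{\rho}\right)\left(\frac{1-e^{-\frac{1}{1+\rho}\mathcal{E}_0(\rho,p_{\tilde X},p_{Y|X})}}{\sqrt{\chi^2(p_{\tilde W}\parallel p_{W|X=x_0})}}\right).$$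
   Context: $\log$ is the natural logarithm, $\delta$ the Dirac delta, $\mathsf{W}_0$ the principal branch of the Lambert W function, and $\chi^2(p\parallel q)=\int\frac{(p-q)^2}{q}$ the chi-squared distance. Gallager's function is $$\mathcal{E}_0(\rho,p,p_{Y|X})=-\log\int_{\mathcal{Y}}\left\{\int_{\mathcal{X}}p(x)\left[p_{Y|X}(y|x)\right]^{\frac{1}{1+\rho}}dx\right\}^{1+\rho}dy.$$ Setting: a code is a list of $M$ code words in $\mathcal{X}^n$; in the ensemble, code words are generated independently with i.i.d. letters of distribution $p_X$. Messages are equally likely; message $m$ is sent by transmitting its code word over $n$ independent uses of $p_{Y|X}$, the receiver knows the code, and a decoding error occurs when the decoded message differs from $m$; the average is over messages. The detector does not know the code, only $p_X$, and tests from $\boldsymbol{w}\in\mathcal{W}^n$ the hypothesis $\mathcal{H}_0$: density $\prod_i p_{W|X}(w_i|x_0)$ (no transmission) against $\mathcal{H}_1$: density $\prod_i p_W(w_i)$ with $p_W(w)=\int p_X(x)p_{W|X}(w|x)\,dx$. With $\alpha,\beta$ the false and miss detection probabilities, ''probability of detection not exceeding $\epsilon_{\rm det}$'' means that the test minimising $\alpha+\beta$ satisfies $\alpha+\beta\ge1-\epsilon_{\rm det}$. Standing assumptions: $p_W$ is dominated by $p_{W|X=x_0}$ and $p_Y$ (with $p_Y(y)=\int p_X(x)p_{Y|X}(y|x)\,dx$) is dominated by $p_{Y|X=x_0}$, i.e. each vanishes wherever the dominating density vanishes. *)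

(* Defs.v *)
From HB Require Import structures.
From mathcomp Require Import all_boot all_order all_algebra.
From mathcomp Require Import all_classical all_reals all_analysis.
Set Implicit Arguments.
Unset Strict Implicit.
Unset Printing Implicit Defensive.
Import Order.TTheory GRing.Theory Num.Theory.
Import numFieldNormedType.Exports.
Local Open Scope classical_set_scope.
Local Open Scope ring_scope.

Definition tcons (T : Type) (n : nat) (p : T * n.-tuple T) : n.+1.-tuple T :=
  [tuple of p.1 :: p.2].

Section tuple_product_step.
Local Open Scope ereal_scope.
Context d (T : measurableType d) (R : realType) (n : nat).
Variable m : {sigma_finite_measure set T -> \bar R}.
Variable mn : {sigma_finite_measure set (n.-tuple T) -> \bar R}.

Let mtcons : measurable_fun [set: T * n.-tuple T] (@tcons T n).
Proof. exact: measurable_cons. Qed.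

Definition tuple_product_step : set (n.+1.-tuple T) -> \bar R :=
  pushforward (m \x mn) (@tcons T n).

Let step0 : tuple_product_step set0 = 0.
Proof. by rewrite /tuple_product_step /pushforward preimage_set0 measure0. Qed.

Let step_ge0 A : 0 <= tuple_product_step A.
Proof. exact: measure_ge0. Qed.

Let step_sigma_additive : semi_sigma_additive tuple_product_step.
Proof.
move=> F mF tF mUF; rewrite /tuple_product_step /pushforward preimage_bigcup.
apply: measure_semi_sigma_additive.
- by move=> k; rewrite -[X in measurable X]setTI; exact: mtcons.
- apply/trivIsetP => /= i j _ _ ij; rewrite -preimage_setI.
  by move/trivIsetP : tF => /(_ _ _ _ _ ij) ->//; rewrite preimage_set0.
- by rewrite -preimage_bigcup -[X in measurable X]setTI; exact: mtcons.
Qed.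

HB.instance Definition _ := isMeasure.Build _ _ _ tuple_product_step
  step0 step_ge0 step_sigma_additive.

Let step_sigma_finite : sigma_finite setT tuple_product_step.
Proof.
have /sigma_finiteP[F [TF ndF Foo]] := sigma_finiteT m.
have /sigma_finiteP[G [TG ndG Goo]] := sigma_finiteT mn.
pose uncons (t : n.+1.-tuple T) : T * n.-tuple T :=
  (thead t, [tuple of behead t]).
have muncons : measurable_fun setT uncons.
  apply/measurable_fun_pairP; split; first exact: measurable_tnth.
  exact: measurable_behead.
have tconsK : cancel (@tcons T n) uncons.
  by move=> [x t]; congr pair; exact/val_inj.
exists (fun k => uncons @^-1` (F k `*` G k)) => [|k].
  rewrite -preimage_bigcup -[LHS](preimage_setT uncons); congr (_ @^-1` _).
  apply/seteqP; split=> // -[x t] _ /=.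
  have [i _ Fi] : (\bigcup_k F k) x by rewrite -TF.
  have [j _ Gj] : (\bigcup_k G k) t by rewrite -TG.
  exists (maxn i j) => //; split => /=.
    by move: Fi; exact/subsetPset/ndF/leq_maxl.
  by move: Gj; exact/subsetPset/ndG/leq_maxr.
have [mF Fkoo] := Foo k; have [mG Gkoo] := Goo k.
split; first by rewrite -[X in measurable X]setTI; apply: muncons => //; exact: measurableX.
rewrite /tuple_product_step /pushforward -comp_preimage.
rewrite (_ : _ \o _ = id) ?preimage_id; last by apply/funext => p /=; rewrite tconsK.
by rewrite product_measure1E// lte_mul_pinfty// ge0_fin_numE.
Qed.

HB.instance Definition _ := Measure_isSigmaFinite.Build _ _ _
  tuple_product_step step_sigma_finite.

End tuple_product_step.

Section definitions.
Context (R : realType).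

Fixpoint tuple_product d (T : measurableType d)
    (m : {sigma_finite_measure set T -> \bar R}) (n : nat) :
    {sigma_finite_measure set (n.-tuple T) -> \bar R} :=
  match n with
  | 0%N => dirac [tuple]
  | n'.+1 => tuple_product_step m (tuple_product m n')
  end.

Lemma tuple_productE d (T : measurableType d)
    (m : {sigma_finite_measure set T -> \bar R}) n (A : 'I_n -> set T) :
  (forall i, measurable (A i)) ->
  (tuple_product m n [set t | forall i, A i (tnth t i)] =
   \prod_(i < n) m (A i))%E.
Proof.
elim: n A => [|n IHn] A mA.
  by rewrite big_ord0 /= diracE mem_set// => -[].
rewrite big_ord_recl -IHn// /= /tuple_product_step /pushforward.
pose B := [set t : n.-tuple T | forall i, A (lift ord0 i) (tnth t i)].
have mB : measurable B.
  rewrite (_ : B = \bigcap_(i in [set: 'I_n])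
      ((fun t => tnth t i) @^-1` A (lift ord0 i))).
    apply: fin_bigcap_measurable => // i _.
    by rewrite -[X in measurable X]setTI; exact: measurable_tnth.
  by apply/seteqP; split=> t Bt i => [_|]; exact: Bt.
rewrite -product_measure1E//; congr (_ _).
apply/seteqP; split=> -[x t] /= => [Ax|[Ax0 At] i].
  split; first exact: (Ax ord0).
  by move=> i; have := Ax (lift ord0 i); rewrite tnthS.
by case: (unliftP ord0 i) => [j|] ->//; rewrite tnthS.
Qed.

Definition log2 (x : R) : R := ln x / ln 2.

(* Principal branch: the solution [w >= -1] of [w e^w = x], for
   [x >= -1/e] (junk value 0 below). *)
Definition lambertW0 (x : R) : R :=
  xget 0 [set w : R | -1 <= w /\ w * expR w = x].

Definition xi (eps_det : R) : R := expR (- (lambertW0 (4 * eps_det ^+ 2) / 2)).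

Section channel.
Context dX dY (X : measurableType dX) (Y : measurableType dY).
Variable mu : {sigma_finite_measure set Y -> \bar R}.

(* [p x y] stands for p(y|x), a density in [y] with respect to [mu]. *)
Definition channel_density (p : X -> Y -> R) : Prop :=
  [/\ forall x y, 0 <= p x y,
      measurable_fun setT (fun z : X * Y => p z.1 z.2)
    & forall x, (\int[mu]_y (p x y)%:E = 1)%E].

(* Input densities may contain Dirac masses: they are probability measures
   [P] on [X], and the integral of p(x) f(x) dx is [\int[P]_x f x].  The output
   density is extended-real valued as it may be infinite on a null set. *)
Definition output_density (P : probability X R) (p : X -> Y -> R)
    (y : Y) : \bar R :=
  (\int[P]_x (p x y)%:E)%E.

Definition dominated (p q : Y -> \bar R) : Prop :=
  {ae mu, forall y, q y = 0%E -> p y = 0%E}.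

(* With the conventions of [\bar R], the integrand is 0 where p = q = 0 and
   +oo where q = 0 < p. *)
Definition chi2 (p q : Y -> \bar R) : \bar R :=
  (\int[mu]_y ((p y - q y) ^+ 2 / q y))%E.

(* For a channel density and [0 < rho] the outer integral lies in ]0, 1], so
   that [fine] and [ln] do not take default values. *)
Definition gallager_E0 (rho : R) (P : probability X R) (p : X -> Y -> R) : R :=
  - ln (fine (\int[mu]_y
      (\int[P]_x ((p x y) `^ (1 + rho)^-1)%:E) `^ (1 + rho))%E).

Definition memoryless (p : X -> Y -> R) (n : nat)
    (x : n.-tuple X) (y : n.-tuple Y) : \bar R :=
  (\prod_(i < n) (p (tnth x i) (tnth y i))%:E)%E.

Definition is_decoder (n M : nat) (g : n.-tuple Y -> 'I_M) : Prop :=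
  forall m, measurable (g @^-1` [set m]).

Definition avg_error (p : X -> Y -> R) (n M : nat)
    (C : M.-tuple (n.-tuple X)) (g : n.-tuple Y -> 'I_M) : \bar R :=
  ((M%:R^-1)%:E * \sum_(m < M)
    \int[tuple_product mu n]_(y in [set y | g y <> m])
      memoryless p (tnth C m) y)%E.

End channel.

(* Letters and code words of the random code are independent with law [P]. *)
Definition code_ensemble dX (X : measurableType dX) (P : probability X R)
    (n M : nat) : {sigma_finite_measure set (M.-tuple (n.-tuple X)) -> \bar R} :=
  tuple_product (tuple_product P n) M.

Definition sparse_signalling dX (X : measurableType dX) (x0 : X) (tau : R)
    (PXt PX : probability X R) : Prop :=
  forall A, measurable A ->
    (PX A = (1 - tau)%:E * \d_x0 A + tau%:E * PXt A)%E.

Section detection.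
Context dW (W : measurableType dW).
Variable mu : {sigma_finite_measure set W -> \bar R}.
Variable n : nat.

Definition iid_density (p : W -> \bar R) (w : n.-tuple W) : \bar R :=
  (\prod_(i < n) p (tnth w i))%E.

(* A test is the measurable region [A] where H1 is declared; [p0] and [p1] are
   the letter densities under H0 and H1. *)
Definition false_detection (p0 : W -> \bar R) (A : set (n.-tuple W)) : \bar R :=
  (\int[tuple_product mu n]_(w in A) iid_density p0 w)%E.

Definition miss_detection (p1 : W -> \bar R) (A : set (n.-tuple W)) : \bar R :=
  (\int[tuple_product mu n]_(w in ~` A) iid_density p1 w)%E.

Definition optimal_test (p0 p1 : W -> \bar R) (A : set (n.-tuple W)) : Prop :=
  measurable A /\
  forall B, measurable B ->
    (false_detection p0 A + miss_detection p1 A <=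
     false_detection p0 B + miss_detection p1 B)%E.

Definition detection_prob_le (p0 p1 : W -> \bar R) (eps : R) : Prop :=
  exists A, optimal_test p0 p1 A /\
    ((1 - eps)%:E <= false_detection p0 A + miss_detection p1 A)%E.

End detection.

Definition sparsity (n : nat) (eps_det chi : R) : R :=
  2 * xi eps_det * eps_det / Num.sqrt (n%:R * chi).

Definition Lrate (eps_det E0 chi rho : R) : R :=
  2 * xi eps_det / ln 2 * ((1 + rho) / rho) *
  ((1 - expR (- (1 + rho)^-1 * E0)) / Num.sqrt chi).

End definitions.

(* Main.v *)
Require Import Defs.
From HB Require Import structures.
From mathcomp Require Import all_boot all_order all_algebra.
From mathcomp Require Import all_classical all_reals all_analysis.
From mathcomp Require Import measurable_realfun ring lra.
Set Implicit Arguments.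
Unset Strict Implicit.
Unset Printing Implicit Defensive.
Import Order.TTheory GRing.Theory Num.Theory.
Import numFieldNormedType.Exports.
Local Open Scope classical_set_scope.
Local Open Scope ring_scope.

(** Detection.  Let [a] and [b] be the letter densities under H0 and H1.  Under
    sparse signalling [\int b^2 / a = 1 + tau^2 chi], so over [n] letters the
    chi-squared distance is [(1 + tau^2 chi)^n - 1 <= e^w - 1] with
    [w = n tau^2 chi = W_0(4 eps_det^2)], and [e^w - 1 <= w e^w = 4 eps_det^2].
    Completing the square bounds the total variation distance by half of the
    square root of this, that is by [eps_det].

    Decoding.  Gallager's union bound with maximum likelihood decoding gives a
    mean error of at most [(M - 1)^rho J^n] with [J = e^(- E_0(rho, p_X))], and
    Minkowski's inequality in [L^(1 + rho)] gives
    [J <= (1 - tau kappa)^(1 + rho) <= e^(- tau kappa (1 + rho))] for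
    [kappa = 1 - e^(- E_0(rho, p_Xt) / (1 + rho))].  One code size has to serve
    every [rho]: take the least [M] that dominates all the claimed bounds
    [2^rate(rho)].  Then [M - 1 < 2^rate(rho)] for some [rho], and for this
    [rho] the error is at most [eps_dec].  The rates are bounded above because
    [kappa] tends to 0 with [rho] (Fatou's lemma), so that the negative term
    [log2 eps_dec / rho] dominates near [rho = 0]. *)

(** * Product measures on tuples *)

Section tuple_product_integral.
Local Open Scope ereal_scope.

Lemma emeasurable_prod d (T : measurableType d) (R : realType) (I : Type)
    (s : seq I) (h : I -> T -> \bar R) :
  (forall i, measurable_fun setT (h i)) ->
  measurable_fun setT (fun x => \prod_(i <- s) h i x).
Proof.
move=> mh; elim: s => [|i s IHs].
  by under eq_fun do rewrite big_nil; exact: measurable_cst.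
by under eq_fun do rewrite big_cons; exact: emeasurable_funM.
Qed.

Context d (T : measurableType d) (R : realType).
Variable m : {sigma_finite_measure set T -> \bar R}.

Lemma measurable_tcons n : measurable_fun [set: T * n.-tuple T] (@tcons T n).
Proof. by apply: measurable_cons; [exact: measurable_fst|exact: measurable_snd]. Qed.

Lemma measurable_prod_tnth n (f : 'I_n -> T -> \bar R) :
  (forall i, measurable_fun setT (f i)) ->
  measurable_fun setT (fun t : n.-tuple T => \prod_(i < n) f i (tnth t i)).
Proof.
move=> mf; apply: emeasurable_prod => i.
exact: (measurableT_comp (mf i) (measurable_tnth i)).
Qed.

(** The measure on [n.+1] letters is by construction the image of a binary product under [tcons], so
    Tonelli's theorem splits off the first letter and induction does the rest. *)
Lemma integral_tuple_prod n (f : 'I_n -> T -> \bar R) :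
  (forall i, measurable_fun setT (f i)) -> (forall i x, 0 <= f i x) ->
  \int[tuple_product m n]_t \prod_(i < n) f i (tnth t i) =
  \prod_(i < n) \int[m]_x f i x.
Proof.
elim: n f => [|n IHn] f mf f0.
  under eq_integral do rewrite big_ord0.
  by rewrite big_ord0 /= integral_dirac//= diracT mule1.
rewrite big_ord_recl -IHn//.
rewrite /= /tuple_product_step ge0_integral_pushforward//=; last 3 first.
- exact: measurable_tcons.
- exact: measurable_prod_tnth.
- by move=> t _; apply: prode_ge0 => i _.
rewrite preimage_setT fubini_tonelli1//=; last 2 first.
- exact: (measurableT_comp (measurable_prod_tnth mf) (@measurable_tcons n)).
- by move=> t; apply: prode_ge0 => i _.
rewrite /fubini_F/=.
transitivity (\int[m]_x (f ord0 x *
    \int[tuple_product m n]_t \prod_(i < n) f (lift ord0 i) (tnth t i))).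
  congr integral; apply/funext => x; rewrite -ge0_integralZl//; last 2 first.
  - by apply: (@measurable_prod_tnth _ (fun i => f (lift ord0 i))) => i.
  - by move=> t _; apply: prode_ge0 => i _.
  congr integral; apply/funext => t; rewrite big_ord_recl; congr (_ * _).
  by apply: eq_bigr => i _; rewrite tnthS.
rewrite -ge0_integralZr//.
by apply: integral_ge0 => t _; apply: prode_ge0 => i _.
Qed.

Lemma tuple_productT n : m setT = 1 -> tuple_product m n setT = 1.
Proof.
move=> m1; have := @tuple_productE R _ _ m n (fun=> setT) (fun=> measurableT).
rewrite big1// => <-; congr (tuple_product m n _).
by apply/seteqP; split.
Qed.

End tuple_product_integral.

(** * Detection *)

Section detection_arith.
Context (R : realType).

(** [lambertW0] picks a root by [xget], so its equation needs a witness; the intermediate value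
    theorem on [[0, x]] gives one because [0 <= x <= x e^x]. The equation then forces the chosen
    root to be positive. *)
Lemma lambertW0P (x : R) : 0 < x ->
  0 < lambertW0 x /\ lambertW0 x * expR (lambertW0 x) = x.
Proof.
move=> x0; have [w1 wE] : [set w : R | -1 <= w /\ w * expR w = x] (lambertW0 x).
  apply: xgetPex.
  have cf : continuous (fun w : R => w * expR w).
    by move=> w; apply: cvgM; [exact: cvg_id|exact: continuous_expR].
  have [||c] := @IVT R (fun w => w * expR w) 0 x x (ltW x0).
  - by apply: continuous_subspaceT.
  - rewrite mul0r ge_min ltW//= le_max; apply/orP; right.
    by rewrite ler_peMr ?ltW// -expR0 ltr_expR.
  rewrite in_itv/= => /andP[c0 _] cE; exists c; split => //.
  by rewrite (le_trans _ c0)// lerN10.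
split; last by [].
by rewrite -(pmulr_lgt0 _ (expR_gt0 (lambertW0 x))) wE.
Qed.

(* Since [b^2 / a = 2 b - a + (b - a)^2 / a], the claim is
   [|b - a| / 2 <= e a / 2 + (b - a)^2 / (8 e a)], a completed square. *)
Lemma min_chi2_lower_bound (e a : R) (b : \bar R) : 0 < e -> 0 <= a -> (0 <= b)%E ->
  ((2^-1)%:E * (a%:E + b) + ((4 * e)^-1)%:E * b <=
   mine a%:E b + (e / 2)%:E * a%:E +
   ((8 * e)^-1)%:E * (b ^+ 2 / a%:E) + ((8 * e)^-1)%:E * a%:E)%E.
Proof.
move=> e0 a0; have e8 : 0 < (8 * e)^-1 by rewrite invr_gt0 mulr_gt0.
case: b => [b| |//].
- rewrite lee_fin => b0; have [a00|an0] := eqVneq a 0.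
    rewrite a00 inver eqxx; have [->|bn0] := eqVneq b 0.
      by rewrite expe2 !mule0 mul0e mule0 !adde0 minxx mule0.
    have -> : (b%:E ^+ 2 * +oo = +oo)%E.
      by rewrite gt0_muley// -EFin_expe lte_fin exprn_gt0// lt0r bn0.
    have -> : (((8 * e)^-1)%:E * +oo = +oo)%E by rewrite gt0_muley.
    by rewrite min_l ?lee_fin// !mule0 !adde0 add0e leey.
  have {an0}a0 : 0 < a by rewrite lt0r an0.
  rewrite inver gt_eqF// -EFin_min -EFin_expe -!EFinM -!EFinD lee_fin.
  have -> : (8 * e)^-1 * (b ^+ 2 / a) = (8 * e)^-1 * (2 * b - a) +
      (8 * e)^-1 * ((b - a) ^+ 2 / a) by field; rewrite !gt_eqF.
  suff : `|b - a| / 2 <= e / 2 * a + (8 * e)^-1 * ((b - a) ^+ 2 / a).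
    have -> : (4 * e)^-1 * b = (8 * e)^-1 * (2 * b) by field; rewrite gt_eqF.
    rewrite minEle; case: ifPn => [ab|]; first by rewrite ger0_norm ?subr_ge0//; lra.
    by rewrite -ltNge => ba; rewrite ltr0_norm ?subr_lt0//; lra.
  rewrite -real_normK ?num_real//; set d := `|_|.
  rewrite -subr_ge0 (_ : _ - _ = (2 * e * a - d) ^+ 2 / (8 * e * a)).
    by rewrite divr_ge0 ?sqr_ge0// !mulr_ge0 ?ltW.
  by field; rewrite !gt_eqF.
- move=> _; rewrite expe2 mulyy.
  rewrite [(+oo / _)%E]gt0_mulye.
    have -> : (((8 * e)^-1)%:E * +oo = +oo)%E by rewrite gt0_muley.
    by rewrite min_l ?leey// -!EFinM -EFinD addey// addye// leey.
  by rewrite inver; case: ifPn => // an0; rewrite lte_fin invr_gt0 lt0r an0.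
Qed.

End detection_arith.

(** * Chi-squared identities for mixtures and products, with infinite values *)

Section chi2_arith.
Context (R : realType).
Local Open Scope ereal_scope.

(** The pointwise form of [\int b^2 / a = 1 + t^2 chi], arranged so that no linear term is
    subtracted. When [a = 0 < b] or [b = +oo], both sides are [+oo] since [t > 0]. *)
Lemma chi2_mixture (t a : R) (b : \bar R) : (0 < t <= 1)%R -> (0 <= a)%R -> 0 <= b ->
  ((1 - t)%:E * a%:E + t%:E * b) ^+ 2 / a%:E + (2 * t)%:E * a%:E =
  a%:E + (2 * t)%:E * b + (t ^+ 2)%:E * ((b - a%:E) ^+ 2 / a%:E).
Proof.
move=> /andP[t0 t1] a0; case: b => [b| |//].
- rewrite lee_fin => b0; rewrite -!EFinM -EFinD -EFinB -!EFin_expe.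
  have [->|an0] := eqVneq a 0%R; last first.
    rewrite inver (negbTE an0) -!EFinM -!EFinD; congr EFin.
    by field.
  rewrite inver eqxx !mulr0 add0r subr0 adde0 add0e.
  have [->|bn0] := eqVneq b 0%R.
    by rewrite !mulr0 expr2 mulr0 mul0e mule0 adde0.
  have b_gt0 : (0 < b)%R by rewrite lt0r bn0.
  rewrite (gt0_muley (x := ((t * b) ^+ 2)%:E)) ?lte_fin ?exprn_gt0 ?mulr_gt0//.
  rewrite (gt0_muley (x := (b ^+ 2)%:E)) ?lte_fin ?exprn_gt0//.
  by rewrite (gt0_muley (x := (t ^+ 2)%:E)) ?lte_fin ?exprn_gt0.
- move=> _; rewrite (gt0_muley (x := t%:E)) ?lte_fin//.
  rewrite (gt0_muley (x := (2 * t)%:E)) ?lte_fin ?mulr_gt0//.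
  have -> : +oo - a%:E = +oo by [].
  rewrite -EFinM addey// !expe2 mulyy.
  have -> : +oo / a%:E = +oo.
    rewrite gt0_mulye// inver; case: ifPn => // an0.
    by rewrite lte_fin invr_gt0 lt0r an0.
  have -> : (t ^+ 2)%:E * +oo = +oo by rewrite gt0_muley// lte_fin exprn_gt0.
  by rewrite -EFinM addye// addey// addye.
Qed.

(** Makes the chi-squared integrand of a word a product over its letters, so that its integral
    factors. *)
Lemma prode_sqr_div (I : Type) (s : seq I) (a : I -> R) (b : I -> \bar R) :
  (forall i, (0 <= a i)%R) ->
  \prod_(i <- s) (b i ^+ 2 / (a i)%:E) =
  (\prod_(i <- s) b i) ^+ 2 / (\prod_(i <- s) a i)%:E.
Proof.
move=> a0; elim: s => [|i s IHs].
  by rewrite !big_nil inver oner_eq0 invr1 expe2 !mule1.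
rewrite !big_cons {}IHs EFinM inveM.
  by rewrite !expe2 muleACA; congr (_ * _); rewrite muleACA.
rewrite inveM_defE !lee_fin a0 prodr_ge0// !ltry !implybT /=.
by [].
Qed.

Lemma prode_EFin (I : Type) (s : seq I) (a : I -> R) :
  \prod_(i <- s) (a i)%:E = (\prod_(i <- s) a i)%:E.
Proof.
by elim: s => [|i s IHs]; rewrite ?big_nil// !big_cons IHs EFinM.
Qed.

Lemma prode_const_le n (x : \bar R) (y : R) : 0 <= x -> x <= y%:E ->
  \prod_(i < n) x <= (y ^+ n)%:E.
Proof.
move=> x0 xy; elim: n => [|n IHn]; first by rewrite big_ord0 expr0.
by rewrite big_ord_recl exprS EFinM lee_pmul// prode_ge0.
Qed.

End chi2_arith.

Section detection_bound.
Local Open Scope ereal_scope.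
Context (R : realType) dW (W : measurableType dW).
Variable mu : {sigma_finite_measure set W -> \bar R}.

Lemma measurable_inve_EFin d (T : measurableType d) (a : T -> R) :
  (forall x, (0 <= a x)%R) -> measurable_fun setT a ->
  measurable_fun setT (fun x => ((a x)%:E)^-1).
Proof.
move=> a0 ma; under eq_fun do rewrite inver.
apply: measurable_fun_ifT => //.
- by apply: measurable_fun_eqr => //; exact: measurable_cst.
- apply/measurable_EFinP; under eq_fun do rewrite -powR_inv1//.
  exact: (measurableT_comp (measurable_powR (-1)) ma).
Qed.

(** The least error sum is the integral [I] of the minimum of the two word densities. Integrating
    [min_chi2_lower_bound] bounds [I] from below through the second moment [\int b^2 / a], which
    over [n] letters is at most [k ^+ n]. *)
Lemma detection_prob_le_chi2 n (a : W -> R) (b : W -> \bar R) (k e : R) :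
  (0 < e)%R -> (forall x, (0 <= a x)%R) -> (forall x, 0 <= b x) ->
  measurable_fun setT a -> measurable_fun setT b ->
  \int[mu]_x (a x)%:E = 1 -> \int[mu]_x b x = 1 ->
  \int[mu]_x (b x ^+ 2 / (a x)%:E) <= k%:E ->
  (k ^+ n <= 1 + 4 * e ^+ 2)%R ->
  detection_prob_le mu n (EFin \o a) b e.
Proof.
move=> e0 a0 b0 ma mb a1 b1 chi chin.
pose an (w : n.-tuple W) := (\prod_(i < n) a (tnth w i))%R.
pose bn (w : n.-tuple W) := iid_density b w.
have anE w : iid_density (EFin \o a) w = (an w)%:E by exact: prode_EFin.
have an0 w : (0 <= an w)%R by apply: prodr_ge0.
have bn0 w : 0 <= bn w by apply: prode_ge0.
have maE : measurable_fun setT (EFin \o a) by exact/measurable_EFinP.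
have man : measurable_fun setT (EFin \o an).
  rewrite (_ : _ \o _ = iid_density (EFin \o a)); last by apply/funext.
  exact: (measurable_prod_tnth (fun=> maE)).
have mbn : measurable_fun setT bn by exact: (measurable_prod_tnth (fun=> mb)).
pose cn w := bn w ^+ 2 / (an w)%:E.
pose c x := b x ^+ 2 / (a x)%:E.
have mc : measurable_fun setT c.
  rewrite /c; under eq_fun do rewrite expe2.
  apply: emeasurable_funM.
    exact: emeasurable_funM.
  exact: measurable_inve_EFin.
have c0 x : 0 <= c x.
  by rewrite /c expe2 mule_ge0 ?mule_ge0// inve_ge0 lee_fin.
have cnE : cn = fun w => \prod_(i < n) c (tnth w i).
  by apply/funext => w; rewrite prode_sqr_div.
have mcn : measurable_fun setT cn.
  by rewrite cnE; exact: (measurable_prod_tnth (fun=> mc)).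
have cn0 w : 0 <= cn w by rewrite cnE prode_ge0.
pose mn := tuple_product mu n.
have ian : \int[mn]_w (an w)%:E = 1.
  under eq_integral do rewrite -anE.
  rewrite (@integral_tuple_prod _ _ _ mu n (fun=> EFin \o a))//.
  by rewrite big1.
have ibn : \int[mn]_w bn w = 1.
  by rewrite (@integral_tuple_prod _ _ _ mu n (fun=> b))// big1.
have icn : \int[mn]_w cn w <= (1 + 4 * e ^+ 2)%:E.
  rewrite cnE (@integral_tuple_prod _ _ _ mu n (fun=> c))//.
  apply: le_trans (prode_const_le _ _ chi) _; last by rewrite lee_fin.
  by apply: integral_ge0 => x _; exact: c0.
have mmin : measurable_fun setT (fun w => mine (an w)%:E (bn w)).
  exact: measurable_mine.
have min0 w : 0 <= mine (an w)%:E (bn w) by rewrite le_min bn0 lee_fin an0.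
(* The likelihood ratio test: its error density is at every point the smaller of the two densities,
   and every test pays at least that. *)
pose A := [set w : n.-tuple W | (an w)%:E <= bn w].
have mA : measurable A.
  rewrite (_ : A = setT `&` [set w | 0 <= bn w - (an w)%:E]).
    by apply: emeasurable_fun_c_infty => //; exact: emeasurable_funB.
  by rewrite setTI; apply/funext => w; apply/propext; rewrite /A/mkset -sube_ge0.
have split_min B : measurable B -> \int[mn]_w mine (an w)%:E (bn w) =
    \int[mn]_(w in B) mine (an w)%:E (bn w) +
    \int[mn]_(w in ~` B) mine (an w)%:E (bn w).
  move=> mB; rewrite -ge0_integral_setU//; last 3 first.
  - exact: measurableC.
  - by rewrite setUv.
  - by rewrite disj_set2E setICr.
  by rewrite setUv.
have minA : false_detection mu (EFin \o a) A + miss_detection mu b A =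
    \int[mn]_w mine (an w)%:E (bn w).
  rewrite (split_min _ mA); congr (_ + _); apply: eq_integral => w; rewrite inE /A/=.
    by move=> /min_l ->; rewrite anE.
  by move=> /negP; rewrite -ltNge => /ltW/min_r ->.
exists A; split; first split => // B mB.
  rewrite minA (split_min _ mB); apply: leeD; apply: ge0_le_integral => //.
  - exact: measurable_funTS.
  - by rewrite (funext anE); exact: measurable_funTS.
  - by move=> w _; rewrite anE ge_min lexx.
  - exact: measurableC.
  - exact: measurable_funTS.
  - exact: measurable_funTS.
  - by move=> w _; rewrite ge_min lexx orbT.
rewrite minA; set I := integral _ _ _.
have e2 : (0 <= e / 2)%R by rewrite divr_ge0 ?ltW.
have e4 : (0 <= (4 * e)^-1)%R by rewrite invr_ge0 mulr_ge0 ?ltW.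
have e8 : (0 <= (8 * e)^-1)%R by rewrite invr_ge0 mulr_ge0 ?ltW.
have mZ r (f : n.-tuple W -> \bar R) : measurable_fun setT f ->
    measurable_fun setT (fun w => r%:E * f w).
  by move=> mf; apply: emeasurable_funM => //; exact: measurable_cst.
have Z0 r (x : \bar R) : (0 <= r)%R -> 0 <= x -> 0 <= r%:E * x.
  by move=> r0 x0; rewrite mule_ge0.
have := @ge0_le_integral _ _ _ mn setT measurableT
  (fun w => (2^-1)%:E * ((an w)%:E + bn w) + ((4 * e)^-1)%:E * bn w)
  (fun w => mine (an w)%:E (bn w) + (e / 2)%:E * (an w)%:E +
      ((8 * e)^-1)%:E * cn w + ((8 * e)^-1)%:E * (an w)%:E).
have ma' := mZ _ _ man; have mb' := mZ _ _ mbn; have mc' := mZ _ _ mcn.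
have mab : measurable_fun setT (fun w => (an w)%:E + bn w) by exact: emeasurable_funD.
have mab' := mZ _ _ mab.
have ae0 w : 0 <= (an w)%:E by rewrite lee_fin.
have ab0 w : 0 <= (an w)%:E + bn w by rewrite adde_ge0.
rewrite !ge0_integralD//; last first.
all: try by repeat (apply: emeasurable_funD => //).
all: try by move=> w _; rewrite ?adde_ge0// ?Z0.
rewrite !ge0_integralZl_EFin// !ge0_integralD// ian ibn -/I => H.
have {H} : 1 + (4 * e)^-1%:E <=
    I + (e / 2)%:E + ((8 * e)^-1 * (1 + 4 * e ^+ 2))%:E + ((8 * e)^-1)%:E.
  apply: le_trans (le_trans (H _ _ _ _) _).
  - rewrite mule1 leeD2r// muleDr// mule1.
    by rewrite -EFinD lee_fin; lra.
  - by move=> w _; rewrite adde_ge0// Z0.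
  - exact: emeasurable_funD.
  - by repeat (apply: emeasurable_funD => //).
  - by move=> w _; exact: min_chi2_lower_bound.
  - rewrite !mule1 leeD2r// leeD2l// EFinM.
    by apply: lee_pmul => //; exact: integral_ge0.
have I0 : 0 <= I by exact: integral_ge0.
case: I I0 => [i _| |//]; last by move=> _ _; rewrite leey.
(* All constants on the right add up to [1 / (4 e) + e], so the inequality amounts to
   [1 - e <= I]. *)
rewrite -!EFinD !lee_fin => H; suff : ((8 * e)^-1 * (1 + 4 * e ^+ 2) + (8 * e)^-1 =
  (4 * e)^-1 + e / 2)%R by lra.
by field; rewrite gt_eqF.
Qed.

End detection_bound.

(** * Sparse signalling *)

Section output_density_theory.
Local Open Scope ereal_scope.
Context (R : realType) dX dY (X : measurableType dX) (Y : measurableType dY).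
Variable mu : {sigma_finite_measure set Y -> \bar R}.
Variable p : X -> Y -> R.
Hypothesis hp : channel_density mu p.

Lemma measurable_channel_l x : measurable_fun setT (p x).
Proof.
case: hp => _ mp _; exact: (measurableT_comp mp (measurable_pair1 x)).
Qed.

Lemma measurable_channel_r y : measurable_fun setT (p^~ y).
Proof.
case: hp => _ mp _; exact: (measurableT_comp mp (measurable_pair2 y)).
Qed.

Lemma measurable_channel_mean (P : probability X R) (f : R -> R) :
  (forall x, (0 <= f x)%R) -> measurable_fun setT f ->
  measurable_fun setT (fun y => \int[P]_x (f (p x y))%:E).
Proof.
move=> f0 mf; case: hp => _ mp _.
apply: (measurable_fun_fubini_tonelli_G (fun z : X * Y => (f (p z.1 z.2))%:E)).
  by apply/measurable_EFinP; exact: measurableT_comp.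
by move=> z; rewrite lee_fin.
Qed.

Lemma measurable_output_density (P : probability X R) :
  measurable_fun setT (output_density P p).
Proof.
case: hp => p0 mp _.
apply: (measurable_fun_fubini_tonelli_G (fun z : X * Y => (p z.1 z.2)%:E)).
  exact/measurable_EFinP.
by move=> z; rewrite lee_fin.
Qed.

Lemma output_density_ge0 (P : probability X R) y : 0 <= output_density P p y.
Proof. by case: hp => p0 _ _; apply: integral_ge0 => x _; rewrite lee_fin. Qed.

Lemma integral_output_density (P : probability X R) :
  \int[mu]_y output_density P p y = 1.
Proof.
case: hp => p0 mp p1.
rewrite /output_density -(@fubini_tonelli _ _ _ _ _ P mu
  (fun z : X * Y => (p z.1 z.2)%:E))//.
- under eq_integral do rewrite p1.
  by rewrite integral_cst//= ?mul1e; exact: probability_setT.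
- exact/measurable_EFinP.
- by move=> z; rewrite lee_fin.
Qed.

End output_density_theory.

Section sparse_signalling_theory.
Local Open Scope ereal_scope.
Context (R : realType) dX (X : measurableType dX).

Lemma integral_sparse_signalling (x0 : X) (t : R) (Q P : probability X R)
    (f : X -> \bar R) :
  (0 <= t <= 1)%R -> sparse_signalling x0 t Q P ->
  measurable_fun setT f -> (forall x, 0 <= f x) ->
  \int[P]_x f x = (1 - t)%:E * f x0 + t%:E * \int[Q]_x f x.
Proof.
move=> /andP[t0 t1] hP mf f0.
have t10 : (0 <= 1 - t)%R by rewrite subr_ge0.
pose m := measure_add (mscale (NngNum t10) (dirac x0)) (mscale (NngNum t0) Q).
rewrite (eq_measure_integral m) => [|A mA _]; last first.
  apply: etrans (hP A mA) _; apply/esym.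
  exact: (measure_addE (mscale (NngNum t10) (dirac x0)) (mscale (NngNum t0) Q)).
rewrite ge0_integral_measure_add// !ge0_integral_mscale//.
by rewrite integral_dirac// diracT mul1e.
Qed.

End sparse_signalling_theory.

Section sparse_detection.
Local Open Scope ereal_scope.
Context (R : realType) dX dW (X : measurableType dX) (W : measurableType dW).
Variable mu : {sigma_finite_measure set W -> \bar R}.
Variable p : X -> W -> R.
Hypothesis hp : channel_density mu p.

Lemma output_density_sparse (x0 : X) (t : R) (Q P : probability X R) :
  (0 <= t <= 1)%R -> sparse_signalling x0 t Q P ->
  output_density P p =
  fun w => (1 - t)%:E * (p x0 w)%:E + t%:E * output_density Q p w.
Proof.
move=> t01 hP; apply/funext => w; case: (hp) => p0 _ _.
apply: integral_sparse_signalling hP _ _ => //.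
  by apply/measurable_EFinP; exact: (measurable_channel_r hp).
by move=> x; rewrite lee_fin.
Qed.

(** Integrate [chi2_mixture]: as [p0] and the kernel output density both have integral 1, the two
    terms with factor [2 t] agree and, being finite, cancel even if the distance is infinite. *)
Lemma integral_chi2_sparse (x0 : X) (t : R) (Q P : probability X R) :
  let p0 := fun w => (p x0 w)%:E in
  (0 < t <= 1)%R -> sparse_signalling x0 t Q P ->
  \int[mu]_w (output_density P p w ^+ 2 / p0 w) =
  1 + (t ^+ 2)%:E * chi2 mu (output_density Q p) p0.
Proof.
move=> p0 t01 hP; have /andP[t0 t1] := t01.
case: (hp) => pge0 mp p1.
have mp0 : measurable_fun setT p0.
  by apply/measurable_EFinP; exact: (measurable_channel_l hp).
have mVp0 : measurable_fun setT (fun w => (p0 w)^-1).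
  by apply: measurable_inve_EFin => //; exact: (measurable_channel_l hp).
have p00 w : 0 <= p0 w by rewrite lee_fin.
pose q := output_density Q p.
have mq : measurable_fun setT q by exact: (measurable_output_density hp).
have q0 w : 0 <= q w by exact: (output_density_ge0 hp).
have mP : measurable_fun setT (output_density P p).
  exact: (measurable_output_density hp).
have P0 w : 0 <= output_density P p w by exact: (output_density_ge0 hp).
have mZ r (f : W -> \bar R) : measurable_fun setT f ->
    measurable_fun setT (fun w => r%:E * f w).
  by move=> mf; apply: emeasurable_funM => //; exact: measurable_cst.
have Z0 (r : R) (x : \bar R) : (0 <= r)%R -> 0 <= x -> 0 <= r%:E * x.
  by move=> r0 x0'; rewrite mule_ge0.
pose c w := (q w - p0 w) ^+ 2 / p0 w.
have mc : measurable_fun setT c.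
  rewrite /c; under eq_fun do rewrite expe2.
  by apply: emeasurable_funM => //; apply: emeasurable_funM; exact: emeasurable_funB.
have c0 w : 0 <= c w by rewrite /c mule_ge0 ?inve_ge0// expe2 sqre_ge0.
pose r w := output_density P p w ^+ 2 / p0 w.
have mr : measurable_fun setT r.
  rewrite /r; under eq_fun do rewrite expe2.
  by apply: emeasurable_funM => //; apply: emeasurable_funM.
have r0 w : 0 <= r w by rewrite /r expe2 mule_ge0 ?mule_ge0// inve_ge0.
have rE w : r w + (2 * t)%:E * p0 w = p0 w + (2 * t)%:E * q w + (t ^+ 2)%:E * c w.
  rewrite /r (output_density_sparse _ hP) ?(ltW t0)//.
  exact: chi2_mixture.
have t2 : (0 <= 2 * t)%R by rewrite mulr_ge0 ?ltW.
have tt : (0 <= t ^+ 2)%R by rewrite sqr_ge0.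
have : \int[mu]_w (r w + (2 * t)%:E * p0 w) =
    \int[mu]_w (p0 w + (2 * t)%:E * q w + (t ^+ 2)%:E * c w).
  by apply: eq_integral => w _; exact: rE.
rewrite !ge0_integralD//; last first.
all: try by repeat (apply: emeasurable_funD => //); exact: mZ.
all: try by move=> w _; rewrite ?adde_ge0// ?Z0.
rewrite !ge0_integralZl_EFin// (p1 x0) (integral_output_density hp) mule1.
move=> /(congr1 (fun x => x - (2 * t)%:E)).
by rewrite addeK// addeAC addeK.
Qed.

End sparse_detection.

(** * The error exponent of a letter *)

Section power_mean.
Context (R : realType).

(** Young's inequality with conjugate exponents [1 / r] and [1 / (1 - r)]; the second one
    degenerates at [r = 1], which is treated apart. *)
Lemma young_powR (r z c : R) : 0 < r <= 1 -> 0 <= z -> 0 <= c ->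
  z `^ r * c `^ (1 - r) <= r * z + (1 - r) * c.
Proof.
move=> /andP[r0]; rewrite le_eqVlt => /predU1P[->|r1] z0 c0.
  by rewrite subrr powRr0 powRr1// mulr1 mul1r mul0r addr0.
have r10 : 0 < 1 - r by rewrite subr_gt0.
have := @conjugate_powR R (z `^ r) (c `^ (1 - r)) r^-1 (1 - r)^-1
  (powR_ge0 _ _) (powR_ge0 _ _).
rewrite !invr_gt0 !invrK -!powRrM !divff ?gt_eqF// !powRr1// => /(_ r0 r10) H.
by rewrite [r * z]mulrC [(1 - r) * c]mulrC H// addrC subrK.
Qed.

Lemma convex_combination_powR (k l a b : R) : 1 <= k -> 0 <= l <= 1 ->
  0 <= a -> 0 <= b ->
  ((1 - l) * a + l * b) `^ k <= (1 - l) * a `^ k + l * b `^ k.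
Proof.
move=> k1 /andP[l0 l1] a0 b0.
have l01 : (0 <= l <= 1) by rewrite l0.
have in0 (x : R) : 0 <= x -> x \in `[0, +oo[%classic.
  by move=> x0; rewrite inE /= in_itv/= x0.
have := convex_powR k1 (Itv01 l0 l1) (in0 _ b0) (in0 _ a0).
by rewrite ![(1 - l) * _ + _]addrC; exact.
Qed.

Local Open Scope ereal_scope.

(** Integrating [young_powR] against a constant [c] that bounds the mean gives [H c^(1 - s) <= c],
    that is [H <= c^s], and [c] may be as close to the mean as wanted. *)
Lemma jensen_powR d (T : measurableType d) (P : probability T R) (f : T -> R) (s : R) :
  (0 < s <= 1)%R -> (forall x, (0 <= f x)%R) -> measurable_fun setT f ->
  (\int[P]_x (f x `^ s)%:E) `^ s^-1 <= \int[P]_x (f x)%:E.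
Proof.
move=> s01 f0 mf; have /andP[s0 s1] := s01.
set F := \int[P]_x (f x)%:E; set H := \int[P]_x _.
have H0 : 0 <= H by apply: integral_ge0 => x _; rewrite lee_fin powR_ge0.
have F0 : 0 <= F by apply: integral_ge0 => x _; rewrite lee_fin.
have mfs : measurable_fun setT (fun x => (f x `^ s)%:E).
  by apply/measurable_EFinP; exact: (measurableT_comp (measurable_powR s) mf).
have mfE : measurable_fun setT (EFin \o f) by exact/measurable_EFinP.
(* A positive bound [c] replaces the mean itself, which might be 0 and could then not be divided
   by. *)
suff key (c : R) : (0 < c)%R -> F <= c%:E -> H `^ s^-1 <= c%:E.
  case: F F0 key => [F| |//] F0 key; last by rewrite leey.
  apply/lee_addgt0Pr => e e0; rewrite -EFinD; apply: key.
    by rewrite ltr_wpDl.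
  by rewrite lee_fin lerDl ltW.
move=> c0 Fc.
have cs0 : (0 < c `^ (1 - s))%R by rewrite powR_gt0.
have HH : H * (c `^ (1 - s))%:E <= c%:E.
  rewrite muleC -ge0_integralZl_EFin//; last 2 first.
  - by move=> x _; rewrite lee_fin powR_ge0.
  - exact: ltW.
  have : \int[P]_x (s%:E * (f x)%:E + ((1 - s) * c)%:E) <= c%:E.
    rewrite ge0_integralD//; last 3 first.
    - by move=> x _; rewrite lee_fin mulr_ge0// ltW.
    - by apply: emeasurable_funM => //; exact: measurable_cst.
    - by move=> x _; rewrite lee_fin mulr_ge0// ?subr_ge0// ltW.
    rewrite integral_cst//= probability_setT mule1 ge0_integralZl_EFin//; last 2 first.
    - by move=> x _; rewrite lee_fin.
    - exact: ltW.
    apply: (@le_trans _ _ (s%:E * c%:E + ((1 - s) * c)%:E)).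
      by rewrite leeD2r// lee_wpmul2l// lee_fin ltW.
    by rewrite -EFinM -EFinD lee_fin; lra.
  apply: le_trans; apply: ge0_le_integral => //.
  - by move=> x _; rewrite lee_fin mulr_ge0 ?powR_ge0.
  - by apply: emeasurable_funM => //; exact: measurable_cst.
  - apply: emeasurable_funD => //; apply: emeasurable_funM => //; exact: measurable_cst.
  - move=> x _; rewrite -!EFinM -EFinD lee_fin mulrC young_powR// ltW//.
move: H H0 HH => [H| |//].
- rewrite lee_fin => H0; rewrite -EFinM !lee_fin => HH.
  have -> : c = ((c `^ s) `^ s^-1)%R by rewrite -powRrM divff ?gt_eqF// powRr1 ?ltW.
  rewrite ge0_ler_powR ?nnegrE ?invr_ge0 ?powR_ge0 ?(ltW s0)//.
  rewrite -(ler_pM2r cs0).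
  have -> : (c `^ s * c `^ (1 - s) = c)%R.
    rewrite -powRD; first by rewrite subrKC powRr1 ?ltW.
    by rewrite (gt_eqF c0) implybT.
  by [].
- by move=> _; rewrite gt0_mulye ?lte_fin.
Qed.

(** Minkowski's inequality for functions of norms at most 1 and [c], raised to the [k]-th power. It
    follows from convexity of the power at [f] and [g / c], whose [k]-th powers have integral at
    most 1. *)
Lemma minkowski_mixture d (T : measurableType d) (mu : {measure set T -> \bar R})
    (f : T -> R) (g : T -> \bar R) (k c t : R) :
  (1 <= k)%R -> (0 < c)%R -> (0 < t <= 1)%R ->
  (forall x, (0 <= f x)%R) -> (forall x, 0 <= g x) ->
  measurable_fun setT f -> measurable_fun setT g ->
  \int[mu]_x (f x `^ k)%:E <= 1 -> \int[mu]_x (g x `^ k) <= (c `^ k)%:E ->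
  \int[mu]_x ((1 - t)%:E * (f x)%:E + t%:E * g x) `^ k <=
    ((1 - t + t * c) `^ k)%:E.
Proof.
move=> k1 c0 /andP[t0 t1] f0 g0 mf mg If Ig.
have k0 : (0 < k)%R by exact: lt_le_trans ltr01 k1.
set N := (1 - t + t * c)%R; have tc : (0 < t * c)%R by rewrite mulr_gt0.
have N0 : (0 < N)%R by rewrite ltr_wpDl// subr_ge0.
have Nk0 : (0 <= N `^ k)%R by exact: powR_ge0.
(* The weight for which [(1 - t) f + t g = N ((1 - l) f + l (g / c))]. *)
pose l := (t * c / N)%R.
have l0 : (0 < l)%R by rewrite divr_gt0.
have l1 : (l <= 1)%R by rewrite ler_pdivrMr// mul1r lerDr subr_ge0.
have l01 : (0 <= l <= 1)%R by rewrite (ltW l0).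
have Nl : (N * (1 - l) = 1 - t)%R by rewrite /l /N; field; rewrite gt_eqF.
have A0 : (0 <= N `^ k * (1 - l))%R by rewrite mulr_ge0// subr_ge0.
have B0 : (0 < N `^ k * l * c `^ (- k))%R.
  by apply: mulr_gt0; [apply: mulr_gt0|]; rewrite // powR_gt0.
have mfk : measurable_fun setT (fun x => (f x `^ k)%:E).
  by apply/measurable_EFinP; exact: (measurableT_comp (measurable_powR k) mf).
have mgk : measurable_fun setT (fun x => g x `^ k).
  exact: (measurableT_comp (measurable_poweR k) mg).
have mfE : measurable_fun setT (fun x => (f x)%:E) by exact/measurable_EFinP.
have mZ r (h : T -> \bar R) : measurable_fun setT h ->
    measurable_fun setT (fun w => r%:E * h w).
  by move=> mh; apply: emeasurable_funM => //; exact: measurable_cst.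
have pw x : ((1 - t)%:E * (f x)%:E + t%:E * g x) `^ k <=
    (N `^ k * (1 - l))%:E * (f x `^ k)%:E + (N `^ k * l * c `^ (- k))%:E * g x `^ k.
  case: (g x) (g0 x) => [b| |//].
  - rewrite lee_fin => b0; rewrite -!EFinM -!EFinD lee_fin.
    have -> : ((1 - t) * f x + t * b = N * ((1 - l) * f x + l * (b / c)))%R.
      rewrite mulrDr mulrA Nl; congr (_ + _)%R.
      by rewrite /l; field; rewrite !gt_eqF.
    have bc : (0 <= b / c)%R by rewrite divr_ge0// ltW.
    have fb : (0 <= (1 - l) * f x + l * (b / c))%R.
      by apply: addr_ge0; apply: mulr_ge0; rewrite ?subr_ge0// ltW.
    rewrite powRM ?(ltW N0)//.
    apply: le_trans (ler_wpM2l Nk0 (convex_combination_powR k1 l01 (f0 x) bc)) _.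
    rewrite powRM ?invr_ge0 ?(ltW c0)// mulrDr -!mulrA lerD2l.
    have -> : (c^-1 `^ k = c `^ (- k))%R.
      by rewrite -powR_inv1 ?(ltW c0)// -powRrM mulN1r.
    by rewrite [(b `^ k * _)%R]mulrC.
  - move=> _; rewrite (@poweRyr _ k) ?gt_eqF//.
    by rewrite [X in _ <= _ + X]gt0_muley ?lte_fin// -!EFinM addey ?leey.
apply: (@le_trans _ _ (\int[mu]_x ((N `^ k * (1 - l))%:E * (f x `^ k)%:E +
    (N `^ k * l * c `^ (- k))%:E * g x `^ k))).
  apply: ge0_le_integral => //.
- by move=> x _; exact: poweR_ge0.
- apply: (measurableT_comp (measurable_poweR k)).
  by apply: emeasurable_funD; exact: mZ.
- by apply: emeasurable_funD; exact: mZ.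
rewrite ge0_integralD//; last 4 first.
- by move=> x _; rewrite lee_fin mulr_ge0 ?powR_ge0.
- exact: mZ.
- by move=> x _; rewrite mule_ge0 ?poweR_ge0// lee_fin ltW.
- exact: mZ.
rewrite !ge0_integralZl_EFin ?(ltW B0)//; last 2 first.
- by move=> x _; rewrite poweR_ge0.
- by move=> x _; rewrite lee_fin powR_ge0.
apply: (@le_trans _ _ ((N `^ k * (1 - l))%:E * 1 +
    (N `^ k * l * c `^ (- k))%:E * (c `^ k)%:E)).
  by apply: leeD; apply: lee_wpmul2l => //; rewrite lee_fin ltW.
have ck : (c `^ (- k) * c `^ k = 1)%R by rewrite powRN mulVf// gt_eqF// powR_gt0.
rewrite mule1 -EFinM -EFinD lee_fin.
have -> : (N `^ k * l * c `^ (- k) * c `^ k = N `^ k * l)%R by rewrite -mulrA ck mulr1.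
by rewrite -mulrDr subrK mulr1.
Qed.

End power_mean.

(** * Inferior limits of extended-real sequences *)

Section limn_einf_bounds.
Context (R : realType).
Local Open Scope ereal_scope.
Implicit Types (u : (\bar R)^nat).

Lemma limn_einf_ge u (l : \bar R) :
  (forall a : R, a%:E < l -> exists N, forall k, (N <= k)%N -> a%:E <= u k) ->
  l <= limn_einf u.
Proof.
move=> ul; rewrite limn_einf_lim (cvg_lim _ (@cvg_einfs_sup _ u))//.
have key (a : R) : a%:E < l -> a%:E <= ereal_sup (range (einfs u)).
  move=> /ul[N Nu]; apply: le_trans (ereal_sup_ubound _); last by exists N.
  by apply: le_ereal_inf_tmp => _ [k /= Nk <-]; exact: Nu.
case: l key {ul} => [l| |] key; last by rewrite leNye.
- apply/lee_subgt0Pr => e e0; rewrite -EFinB; apply: key.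
  by rewrite lte_fin ltrBlDr ltrDl.
- by rewrite leye_eq; apply/eqP/eqyP => A A0; apply: key; rewrite ltry.
Qed.

Lemma limn_einf_le u (M : \bar R) : (forall k, u k <= M) -> limn_einf u <= M.
Proof.
move=> uM; rewrite limn_einf_lim (cvg_lim _ (@cvg_einfs_sup _ u))//.
apply: ge_ereal_sup => _ [k _ <-]; apply: le_trans (uM k).
by apply: ereal_inf_lbound; exists k => /=.
Qed.

Lemma lt_limn_einf u (a : \bar R) : a < limn_einf u ->
  exists N, forall k, (N <= k)%N -> a < u k.
Proof.
rewrite limn_einf_lim (cvg_lim _ (@cvg_einfs_sup _ u))//.
move=> /ereal_sup_gt[_ [N _ <-] aN]; exists N => k Nk.
by apply: lt_le_trans aN _; apply: ereal_inf_lbound; exists k.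
Qed.

Lemma measurable_limn_einf d (T : measurableType d) (f : (T -> \bar R)^nat) :
  (forall k, measurable_fun setT (f k)) ->
  measurable_fun setT (fun x => limn_einf (f^~ x)).
Proof.
move=> mf; apply: measurableT_comp; first exact: oppe_measurable.
by apply: measurable_fun_limn_esup => k; exact: measurableT_comp.
Qed.

End limn_einf_bounds.

(** * Gallager's integral for one letter, and its behaviour as [rho] tends to 0 *)

Section gallager_letter.
Context (R : realType) dX dY (X : measurableType dX) (Y : measurableType dY).
Variable mu : {sigma_finite_measure set Y -> \bar R}.
Variable p : X -> Y -> R.
Hypothesis hp : channel_density mu p.

(** From [t^(1 + r) = t e^(r ln t) >= t (1 + r ln t)], it suffices that [|r| |ln t| t <= t - a],
    whence the rank. Both signs of [r] are covered because the exponents [1 + rho] and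
    [1 / (1 + rho)] lie on opposite sides of 1. *)
Lemma near1_powR (a t : R) : 0 < a < t -> exists N : nat, forall k (r : R), (N <= k)%N ->
  `|r| <= k.+1%:R^-1 -> a <= t `^ (1 + r).
Proof.
move=> /andP[a0 ta]; have t0 := lt_trans a0 ta.
exists (Num.bound (`|ln t| * t / (t - a))) => k r Nk rk.
have ta0 : 0 < t - a by rewrite subr_gt0.
have -> : t `^ (1 + r) = t * expR (r * ln t).
  by rewrite /powR gt_eqF// mulrDl mul1r expRD lnK.
have H : t * (1 + r * ln t) <= t * expR (r * ln t).
  by rewrite ler_pM2l// expR_ge1Dx.
apply: le_trans H; rewrite mulrDr mulr1 -lerBlDl -opprB lerNl.
apply: le_trans (ler_norm _) _; rewrite normrN !normrM (gtr0_norm t0).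
have B : `|ln t| * t / (t - a) <= k.+1%:R.
  apply/ltW/(lt_le_trans (archi_boundP _)).
    by rewrite divr_ge0 ?mulr_ge0 ?(ltW t0) ?(ltW ta0).
  by rewrite ler_nat ltnW.
rewrite mulrCA; apply: le_trans (ler_wpM2r _ rk) _.
  by rewrite mulr_ge0// ltW.
by rewrite ler_pdivrMl// [t * _]mulrC -ler_pdivrMr.
Qed.

Local Open Scope ereal_scope.

Definition gallager_integral (rho : R) (P : probability X R) : \bar R :=
  \int[mu]_y (\int[P]_x ((p x y) `^ (1 + rho)^-1)%:E) `^ (1 + rho).

(** The norm in [L^(1 + rho)] of the inner mean of Gallager's integral, provided that this integral
    is nonzero and [0 <= rho]. *)
Definition exponent_ratio (rho : R) (P : probability X R) : R :=
  expR (- (1 + rho)^-1 * gallager_E0 mu rho P p).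

Lemma measurable_gallager_mean (s : R) (P : probability X R) :
  measurable_fun setT (fun y => \int[P]_x ((p x y) `^ s)%:E).
Proof.
apply: (measurable_channel_mean hp P (f := fun z => z `^ s)%R).
- by move=> x; exact: powR_ge0.
- exact: measurable_powR.
Qed.

Lemma gallager_mean_ge0 (s : R) (P : probability X R) y :
  0 <= \int[P]_x ((p x y) `^ s)%:E.
Proof. by apply: integral_ge0 => x _; rewrite lee_fin powR_ge0. Qed.

(** Jensen's inequality with [s = 1 / (1 + rho)] bounds the integrand by the output density, whose
    integral is 1. *)
Lemma gallager_integral_le1 (rho : R) (P : probability X R) : (0 <= rho)%R ->
  gallager_integral rho P <= 1.
Proof.
move=> r0; have [p0 _ _] := hp.
have r1 : (0 < 1 + rho)%R by rewrite ltr_pwDl.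
rewrite -(integral_output_density hp P); apply: ge0_le_integral => //.
- by move=> y _; exact: poweR_ge0.
- apply: (measurableT_comp (measurable_poweR _)).
  exact: measurable_gallager_mean.
- exact: measurable_output_density hp _.
- move=> y _; have := @jensen_powR R _ X P (p^~ y) (1 + rho)^-1; rewrite invrK; apply => //.
  + by rewrite invr_gt0 r1 invf_le1// lerDl.
  + exact: measurable_channel_r hp _.
Qed.

Lemma gallager_integral_ge0 (rho : R) (P : probability X R) :
  0 <= gallager_integral rho P.
Proof. by apply: integral_ge0 => y _; exact: poweR_ge0. Qed.

Lemma gallager_integral_le_ratio (rho : R) (P : probability X R) : (0 <= rho)%R ->
  gallager_integral rho P <= (exponent_ratio rho P `^ (1 + rho))%:E.
Proof.
move=> r0; have r1 : (0 < 1 + rho)%R by rewrite ltr_pwDl.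
have -> : (exponent_ratio rho P `^ (1 + rho) =
    expR (ln (fine (gallager_integral rho P))))%R.
  rewrite /exponent_ratio /gallager_E0 -/(gallager_integral rho P) /powR gt_eqF ?expR_gt0//.
  by rewrite expRK mulrNN mulrA divff ?gt_eqF// mul1r.
have := gallager_integral_le1 P r0; have := gallager_integral_ge0 rho P.
case: (gallager_integral rho P) => [I| |//]; rewrite ?leye_eq// !lee_fin => I0 _.
(* Since [ln 0 = 0], a vanishing integral would give ratio 1: the inequality survives, equality
   would not. *)
have [->|In0] := eqVneq I 0%R; first exact: expR_ge0.
by rewrite lnK// posrE lt0r In0.
Qed.

(** Under [P] the inner mean is a mixture of its value at [x0] and its value under [Q]. The first
    has norm 1 in [L^(1 + rho)] because a channel density integrates to 1, the second has norm at
    most [exponent_ratio rho Q], and Minkowski's inequality combines them. *)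
Lemma gallager_integral_sparse (x0 : X) (rho t : R) (Q P : probability X R) :
  (0 < rho)%R -> (0 < t <= 1)%R -> sparse_signalling x0 t Q P ->
  gallager_integral rho P <=
    ((1 - t * (1 - exponent_ratio rho Q)) `^ (1 + rho))%:E.
Proof.
move=> r0 t01 hP; have [p0 _ p1] := hp; have /andP[t0 t1] := t01.
have r1 : (0 < 1 + rho)%R by rewrite addr_gt0.
have -> : (1 - t * (1 - exponent_ratio rho Q) = 1 - t + t * exponent_ratio rho Q)%R by ring.
have mx0 := measurable_channel_l hp x0.
apply: le_trans (@minkowski_mixture R _ Y mu (fun y => p x0 y `^ (1 + rho)^-1)%R
  (fun y => \int[Q]_x ((p x y) `^ (1 + rho)^-1)%:E) (1 + rho) _ t _ _ _ _ _ _ _ _ _) => //.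
- rewrite /gallager_integral le_eqVlt; apply/orP; left; apply/eqP.
  apply: eq_integral => y _; congr (_ `^ _).
  rewrite (integral_sparse_signalling _ hP) ?(ltW t0)//.
  + apply/measurable_EFinP; apply: (measurableT_comp (measurable_powR _)).
    exact: measurable_channel_r hp _.
  + by move=> x; rewrite lee_fin powR_ge0.
- by rewrite lerDl ltW.
- exact: expR_gt0.
- by move=> y; exact: powR_ge0.
- by move=> y; exact: gallager_mean_ge0.
- exact: (measurableT_comp (measurable_powR _)).
- exact: measurable_gallager_mean.
- rewrite -(p1 x0); under eq_integral do rewrite -powRrM mulVf ?gt_eqF// powRr1//.
  by [].
- exact: gallager_integral_le_ratio (ltW r0).
Qed.

(** Fatou's lemma over the inputs handles the inner exponent [1 / (1 + r k)], and [near1_powR] the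
    outer one; both exponents tend to 1. *)
Lemma liminf_gallager_mean (Q : probability X R) (r : nat -> R) y :
  (forall k, 0 <= r k <= k.+1%:R^-1)%R ->
  output_density Q p y <= limn_einf (fun k =>
    (\int[Q]_x ((p x y) `^ (1 + r k)^-1)%:E) `^ (1 + r k)).
Proof.
move=> hr; have [p0 _ _] := hp.
have inner : output_density Q p y <=
    limn_einf (fun k => \int[Q]_x ((p x y) `^ (1 + r k)^-1)%:E).
  apply: le_trans (fatou _ _ _ _) => //.
  - apply: ge0_le_integral => //.
    + by move=> x _; rewrite lee_fin.
    + by apply/measurable_EFinP; exact: measurable_channel_r hp _.
    + apply: measurable_limn_einf => k; apply/measurable_EFinP.
      apply: (measurableT_comp (measurable_powR _)).
      exact: measurable_channel_r hp _.
    + move=> x _; apply: limn_einf_ge => a; rewrite lte_fin => apx.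
      have [a0|a0] := leP a 0%R.
        by exists 0%N => k _; rewrite lee_fin (le_trans a0)// powR_ge0.
      have [|N HN] := @near1_powR a (p x y); first by rewrite a0.
      exists N => k Nk; rewrite lee_fin; have /andP[rk0 rk1] := hr k.
      have r1 : (0 < 1 + r k)%R by rewrite ltr_pwDl.
      have -> : ((1 + r k)^-1 = 1 + (- (r k / (1 + r k))))%R.
        by field; rewrite gt_eqF.
      apply: HN Nk _; rewrite normrN ger0_norm ?divr_ge0 ?(ltW r1)//.
      by apply: le_trans rk1; rewrite ler_pdivrMr// ler_peMr// lerDl.
  - move=> k; apply/measurable_EFinP; apply: (measurableT_comp (measurable_powR _)).
    exact: measurable_channel_r hp _.
  - by move=> k x _; rewrite lee_fin powR_ge0.
apply: limn_einf_ge => a ap.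
have [a0|a0] := leP a 0%R.
  by exists 0%N => k _; apply: le_trans (poweR_ge0 _ _); rewrite lee_fin.
(* Leaves room between [a] and the output density, to be spent on the outer exponent. *)
have [a' /andP[aa' a'p]] : exists a' : R, (a < a')%R && (a'%:E < output_density Q p y).
  case: (output_density Q p y) ap => [b| |//].
    by rewrite lte_fin => ab; exists ((a + b) / 2)%R; rewrite lte_fin midf_lt//= midf_lt.
  by move=> _; exists (a + 1)%R; rewrite ltrDl ltr01 ltry.
have [N1 HN1] := lt_limn_einf (lt_le_trans a'p inner).
have [|N2 HN2] := @near1_powR a a'; first by rewrite a0.
exists (maxn N1 N2) => k; rewrite geq_max => /andP[k1 k2].
have /andP[rk0 rk1] := hr k.
have r1 : (0 < 1 + r k)%R by rewrite ltr_pwDl.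
apply: (@le_trans _ _ (a'%:E `^ (1 + r k))).
  by rewrite poweR_EFin lee_fin; apply: (HN2 k) => //; rewrite ger0_norm.
have a'0 : (0 <= a')%R by rewrite ltW// (lt_trans a0).
apply: (gt0_ler_poweR (ltW r1)); last exact/ltW/HN1.
- by rewrite in_itv/= lee_fin a'0 leey.
- by rewrite in_itv/= gallager_mean_ge0 leey.
Qed.

(** Otherwise some [r k] tending to 0 would keep Gallager's integral at most [1 - d]; Fatou's lemma
    over the outputs would then bound the total mass 1 of the output density by [1 - d]. *)
Lemma exponent_ratio_near0 (Q : probability X R) (d : R) : (0 < d)%R ->
  exists N : nat, forall rho : R, (0 < rho <= N.+1%:R^-1)%R ->
    (1 - exponent_ratio rho Q <= d)%R.
Proof.
move=> d0; apply: contrapT => /forallNP H.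
have /choice[r hr] : forall k : nat, exists r : R,
    (0 < r <= k.+1%:R^-1)%R /\ (d < 1 - exponent_ratio r Q)%R.
  move=> k; have /existsNP[r /not_implyP[rk /negP]] := H k.
  by rewrite -ltNge => rd; exists r.
have hr' k : (0 <= r k <= k.+1%:R^-1)%R.
  by have [/andP[r0 ->] _] := hr k; rewrite ltW.
have bound k : gallager_integral (r k) Q <= (1 - d)%:E.
  have [/andP[r0 _] rd] := hr k.
  apply: le_trans (gallager_integral_le_ratio Q (ltW r0)) _; rewrite lee_fin.
  have c1 : (exponent_ratio (r k) Q <= 1 - d)%R by lra.
  apply: le_trans c1; apply: ge1r_powR; last by rewrite lerDl ltW.
  by rewrite expR_gt0/=; lra.
have : \int[mu]_y output_density Q p y <= (1 - d)%:E.
  apply: (@le_trans _ _ (\int[mu]_y limn_einf (fun k =>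
    (\int[Q]_x ((p x y) `^ (1 + r k)^-1)%:E) `^ (1 + r k)))).
    apply: ge0_le_integral => //.
    - by move=> y _; exact: output_density_ge0 hp _ _.
    - exact: measurable_output_density hp _.
    - apply: measurable_limn_einf => j; apply: (measurableT_comp (measurable_poweR _)).
      exact: (measurable_gallager_mean (1 + r j)^-1 Q).
    - by move=> y _; exact: liminf_gallager_mean.
  apply: le_trans (fatou _ _ _ _) _ => //.
  - move=> j; apply: (measurableT_comp (measurable_poweR _)).
    exact: (measurable_gallager_mean (1 + r j)^-1 Q).
  - by move=> j y _; exact: poweR_ge0.
  - by apply: limn_einf_le => j; exact: bound.
rewrite (integral_output_density hp) lee_fin; lra.
Qed.

End gallager_letter.

(** * Random coding *)

Section random_coding_letterwise.
Local Open Scope ereal_scope.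
Context (R : realType) d (T : measurableType d).
Variables (m : {sigma_finite_measure set T -> \bar R}) (V : T -> R).
Hypothesis m1 : m setT = 1.
Hypothesis V0 : forall x, (0 <= V x)%R.
Hypothesis mV : measurable_fun setT V.

Let mVE : measurable_fun setT (fun x => (V x)%:E).
Proof. exact/measurable_EFinP. Qed.

Let int1 : \int[m]_x 1 = 1.
Proof. by rewrite -[RHS]m1 -[RHS]mul1e; exact: (integral_cst m measurableT 1). Qed.

Lemma measurable_codeword M (i : 'I_M) :
  measurable_fun setT (fun C : M.-tuple T => V (tnth C i)).
Proof. exact: (measurableT_comp mV (measurable_tnth i)). Qed.

Lemma integral_codeword M (i : 'I_M) :
  \int[tuple_product m M]_C (V (tnth C i))%:E = \int[m]_x (V x)%:E.
Proof.
(* Code words other than the [i]-th contribute the factor 1, which turns the integrand into a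
   product over coordinates. *)
pose f (j : 'I_M) x := if j == i then (V x)%:E else 1.
transitivity (\int[tuple_product m M]_C \prod_(j < M) f j (tnth C j)).
  apply: eq_integral => C _; rewrite /f (bigD1 i)//= eqxx big1 ?mule1//.
  by move=> j /negbTE ->.
rewrite integral_tuple_prod.
- rewrite (bigD1 i)//= /f eqxx big1 ?mule1// => j /negbTE ->.
  exact: int1.
- by move=> j; rewrite /f; case: (j == i) => //; exact: measurable_cst.
- by move=> j x; rewrite /f; case: ifP => _ //; rewrite lee_fin.
Qed.

Lemma integral_codeword2 M (i j : 'I_M) : j != i ->
  \int[tuple_product m M]_C (V (tnth C i) * V (tnth C j))%:E =
  \int[m]_x (V x)%:E * \int[m]_x (V x)%:E.
Proof.
move=> ji; pose f (k : 'I_M) x := if (k == i) || (k == j) then (V x)%:E else 1.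
transitivity (\int[tuple_product m M]_C \prod_(j < M) f j (tnth C j)).
  apply: eq_integral => C _; rewrite /f (bigD1 i)//= eqxx (bigD1 j)//= eqxx orbT.
  rewrite big1 ?mule1// => k /andP[/negbTE -> /negbTE ->]//.
rewrite integral_tuple_prod.
- rewrite (bigD1 i)//= /f eqxx (bigD1 j)//= eqxx orbT big1 ?mule1//.
  move=> k /andP[/negbTE -> /negbTE ->]/=.
  exact: int1.
- by move=> k; rewrite /f; case: (_ || _) => //; exact: measurable_cst.
- by move=> k x; rewrite /f; case: ifP => _ //; rewrite lee_fin.
Qed.

Lemma measurable_rivals M (i : 'I_M) :
  measurable_fun setT (fun C : M.-tuple T => (\sum_(j <- enum (predC1 i)) V (tnth C j))%R).
Proof. by apply: measurable_sum => j; exact: measurable_codeword. Qed.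

Lemma rivals_ge0 M (i : 'I_M) (C : M.-tuple T) :
  (0 <= \sum_(j <- enum (predC1 i)) V (tnth C j))%R.
Proof. by apply: sumr_ge0. Qed.

Let v := \int[m]_x (V x)%:E.
Let E (rho : R) M (i : 'I_M) := \int[tuple_product m M]_C
  (V (tnth C i) * (\sum_(j <- enum (predC1 i)) V (tnth C j)) `^ rho)%:E.

Let sume_const (I : Type) (s : seq I) (a : \bar R) : 0 <= a ->
  \sum_(j <- s) a = (size s)%:R%:E * a.
Proof.
move=> a0; elim: s => [|j s IHs]; first by rewrite big_nil mul0e.
by rewrite big_cons IHs /= -natr1 EFinD ge0_muleDl ?mul1e ?lee_fin// addeC.
Qed.

Let v0 : 0 <= v.
Proof. by apply: integral_ge0 => x _; rewrite lee_fin. Qed.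

(* Young's inequality makes the expectation linear in the rival sum, so that
   pairwise independence of the code words suffices. *)
Lemma rivals_young (rho c : R) M (i : 'I_M) : (0 < rho <= 1)%R -> (0 <= c)%R ->
  E rho i * (c `^ (1 - rho))%:E <=
  rho%:E * (M.-1%:R%:E * (v * v)) + ((1 - rho) * c)%:E * v.
Proof.
move=> r01 c0; have /andP[r0 r1] := r01; have r10 : (0 <= 1 - rho)%R by rewrite subr_ge0.
have mVi := measurable_codeword i; have mZ := measurable_rivals i.
have Z0 := rivals_ge0 i.
have rc0 : (0 <= (1 - rho) * c)%R by rewrite mulr_ge0.
have mVV j : measurable_fun setT (fun C : M.-tuple T => (V (tnth C i) * V (tnth C j))%:E).
  by apply/measurable_EFinP; apply: measurable_funM => //; exact: measurable_codeword.
have VV0 j (C : M.-tuple T) : 0 <= (V (tnth C i) * V (tnth C j))%:E.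
  by rewrite lee_fin mulr_ge0.
have -> : M.-1%:R%:E * (v * v) = \int[tuple_product m M]_C
    \sum_(j <- enum (predC1 i)) (V (tnth C i) * V (tnth C j))%:E.
  rewrite ge0_integral_sum// (eq_big_seq (fun=> v * v)).
    by rewrite sume_const ?mule_ge0// -cardE cardC1 card_ord.
  by move=> j; rewrite mem_enum !inE => ji; exact: integral_codeword2.
have mVZ : measurable_fun setT (fun C : M.-tuple T => (V (tnth C i) *
    (\sum_(j <- enum (predC1 i)) V (tnth C j)) `^ rho)%:E).
  apply/measurable_EFinP; apply: measurable_funM => //.
  exact: (measurableT_comp (measurable_powR rho)).
have ms : measurable_fun setT (fun C : M.-tuple T =>
    \sum_(j <- enum (predC1 i)) (V (tnth C i) * V (tnth C j))%:E).
  by apply: emeasurable_sum.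
have s0 (C : M.-tuple T) : 0 <= \sum_(j <- enum (predC1 i)) (V (tnth C i) * V (tnth C j))%:E.
  by apply: sume_ge0.
have mZl r (f : M.-tuple T -> \bar R) : measurable_fun setT f ->
    measurable_fun setT (fun w => r%:E * f w).
  by move=> mf; apply: emeasurable_funM => //; exact: measurable_cst.
rewrite /v -(integral_codeword i) muleC.
rewrite -!ge0_integralZl_EFin ?powR_ge0 ?(ltW r0)//; last 3 first.
- by move=> C _; rewrite lee_fin.
- by apply/measurable_EFinP.
- by move=> C _; rewrite lee_fin mulr_ge0 ?powR_ge0.
rewrite -ge0_integralD//; last 4 first.
- by move=> C _; rewrite mule_ge0 ?lee_fin ?(ltW r0).
- exact: mZl.
- by move=> C _; rewrite mule_ge0 ?lee_fin.
- by apply: mZl; exact/measurable_EFinP.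
apply: ge0_le_integral => //.
- by move=> C _; rewrite mule_ge0// lee_fin ?mulr_ge0 ?powR_ge0.
- exact: mZl.
- by apply: emeasurable_funD; apply: mZl => //; exact/measurable_EFinP.
move=> C _; rewrite sumEFin -!EFinM -EFinD lee_fin -mulr_sumr.
have := ler_wpM2l (V0 (tnth C i)) (young_powR r01 (Z0 C) c0).
set Z := (\sum_(j <- _) _)%R; rewrite mulrDr => H; apply: le_trans (le_trans H _).
  by rewrite mulrCA [(c `^ _ * _)%R]mulrC.
by rewrite [(rho * (_ * _))%R]mulrCA [((1 - rho) * c * _)%R]mulrC.
Qed.

(** Apply [rivals_young] with [c] equal to the mean [(M - 1) v] of the rival sum: its right-hand
    side becomes [v c], hence [E <= v c^rho]. *)
Lemma rivals_bound (rho : R) M (i : 'I_M) : (0 < rho <= 1)%R ->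
  E rho i <= (M.-1%:R `^ rho)%:E * v `^ (1 + rho).
Proof.
move=> r01; have /andP[r0 r1] := r01.
have E0 : 0 <= E rho i.
  by apply: integral_ge0 => C _; rewrite lee_fin mulr_ge0 ?powR_ge0// rivals_ge0.
(* Without rivals the sum is empty, and its [rho]-th power is 0 because [rho > 0]. *)
have [M1|M1] := eqVneq M.-1 0%N.
  have -> : E rho i = 0.
    rewrite /E; under eq_integral => C _.
      rewrite [X in (_ * X `^ _)%R](_ : _ = 0%R); first by rewrite powR0 ?gt_eqF// mulr0; over.
      have : size (enum (predC1 i)) = 0%N by rewrite -cardE cardC1 card_ord.
      by move/size0nil ->; rewrite big_nil.
    by rewrite integral0.
  by rewrite mule_ge0 ?lee_fin ?powR_ge0 ?poweR_ge0.
have M0 : (0 < M.-1%:R :> R)%R by rewrite ltr0n lt0n.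
have := rivals_young i r01; rewrite -/(E rho i).
case: v v0 => [w| |//]; last first.
  by move=> _ _; rewrite poweRyr ?gt_eqF ?addr_gt0// gt0_muley ?leey// lte_fin powR_gt0.
rewrite lee_fin => w0 Y.
(* A zero mean would make [c] zero; here [c = 1] gives [E <= 0] at once. *)
have [w00|wn0] := eqVneq w 0%R.
  have := Y 1%R ler01; rewrite powR1 mule1 w00 !mule0 adde0 => E00.
  by apply: le_trans E00 _; rewrite mule_ge0// ?lee_fin ?powR_ge0 ?poweR_ge0.
have {wn0}w0 : (0 < w)%R by rewrite lt0r wn0.
set c := (M.-1%:R * w)%R; have c0 : (0 < c)%R by rewrite mulr_gt0.
have := Y c (ltW c0); have cr : (0 < c `^ (1 - rho))%R by rewrite powR_gt0.
case: (E rho i) E0 => [e| |//] e0; last by rewrite gt0_mulye// -!EFinM -EFinD.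
rewrite -!EFinM -EFinD !lee_fin => H.
rewrite -(ler_pM2r cr); apply: le_trans H _.
have -> : (w `^ (1 + rho) = w * w `^ rho)%R.
  by rewrite powRD ?powRr1 ?(ltW w0)// (gt_eqF w0) implybT.
have cc : (c `^ rho * c `^ (1 - rho) = c)%R.
  rewrite -powRD; first by rewrite subrKC powRr1 ?ltW.
  by rewrite (gt_eqF c0) implybT.
have -> : (M.-1%:R `^ rho * (w * w `^ rho) * c `^ (1 - rho) = w * c)%R.
  by rewrite mulrCA -powRM ?ler0n ?(ltW w0)// -mulrA cc.
by rewrite /c; lra.
Qed.

End random_coding_letterwise.

(** * Gallager's union bound averaged over random codes *)

Section random_coding.
Local Open Scope ereal_scope.
Context (R : realType) dX dY (X : measurableType dX) (Y : measurableType dY).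
Variable mu : {sigma_finite_measure set Y -> \bar R}.
Variable p : X -> Y -> R.
Hypothesis hp : channel_density mu p.

Lemma poweR_prod (I : Type) (s : seq I) (f : I -> \bar R) (r : R) :
  (forall i, 0 <= f i) ->
  (\prod_(i <- s) f i) `^ r = \prod_(i <- s) (f i `^ r).
Proof.
move=> f0; elim: s => [|i s IHs]; first by rewrite !big_nil poweR1r.
by rewrite !big_cons poweRM ?IHs ?prode_ge0.
Qed.

(** A power of the likelihood of [c], written letterwise so that its mean over random letters
    factors. *)
Definition word_weight n (s : R) (y : n.-tuple Y) (c : n.-tuple X) : R :=
  \prod_(k < n) ((p (tnth c k) (tnth y k)) `^ s)%R.

(* With [s = 1 / (1 + rho)], the exponents satisfy [1 - s rho = s]. *)
Definition union_bound n (rho : R) M (i : 'I_M) (C : M.-tuple (n.-tuple X))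
    (y : n.-tuple Y) : R :=
  let V := word_weight (1 + rho)^-1 y in
  (V (tnth C i) * (\sum_(j <- enum (predC1 i)) V (tnth C j)) `^ rho)%R.

Lemma word_weight_ge0 n s (y : n.-tuple Y) c : (0 <= word_weight s y c)%R.
Proof. by apply: prodr_ge0 => k _; exact: powR_ge0. Qed.

Lemma union_bound_ge0 n rho M (i : 'I_M) (C : M.-tuple (n.-tuple X)) y :
  (0 <= union_bound rho i C y)%R.
Proof. by rewrite mulr_ge0 ?powR_ge0 ?word_weight_ge0. Qed.

Lemma word_weightE n (s : R) (y : n.-tuple Y) (c : n.-tuple X) :
  word_weight s y c = ((\prod_(k < n) p (tnth c k) (tnth y k)) `^ s)%R.
Proof.
have [p0 _ _] := hp; rewrite /word_weight.
elim: (index_enum _) => [|k r IHr]; first by rewrite !big_nil powR1.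
by rewrite !big_cons powRM ?IHr ?prodr_ge0.
Qed.

(** With both words depending on a parameter, one statement yields joint measurability as well as
    measurability with one word fixed. *)
Lemma measurable_word_weight2 d (T : measurableType d) n s
    (c : T -> n.-tuple X) (y : T -> n.-tuple Y) :
  measurable_fun setT c -> measurable_fun setT y ->
  measurable_fun setT (fun t => word_weight s (y t) (c t)).
Proof.
have [_ mp _] := hp; move=> mc my; apply: measurable_prod => k _.
apply: (measurableT_comp (measurable_powR s)).
have mk : measurable_fun setT (fun t => (tnth (c t) k, tnth (y t) k)).
  apply/measurable_fun_pairP; split.
    exact: (measurableT_comp (measurable_tnth k) mc).
  exact: (measurableT_comp (measurable_tnth k) my).
exact: (measurableT_comp mp mk).
Qed.

Lemma measurable_union_bound2 d (T : measurableType d) n rho M (i : 'I_M)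
    (C : T -> M.-tuple (n.-tuple X)) (y : T -> n.-tuple Y) :
  measurable_fun setT C -> measurable_fun setT y ->
  measurable_fun setT (fun t => union_bound rho i (C t) (y t)).
Proof.
move=> mC my.
have mV j : measurable_fun setT (fun t => word_weight (1 + rho)^-1 (y t) (tnth (C t) j)).
  apply: measurable_word_weight2 => //.
  exact: (measurableT_comp (measurable_tnth j) mC).
apply: measurable_funM => //; apply: (measurableT_comp (measurable_powR rho)).
exact: measurable_sum.
Qed.

Lemma integral_word_weight (P : probability X R) n s (y : n.-tuple Y) :
  \int[tuple_product P n]_c (word_weight s y c)%:E =
  \prod_(k < n) \int[P]_x ((p x (tnth y k)) `^ s)%:E.
Proof.
rewrite -(integral_tuple_prod P (f := fun k x => ((p x (tnth y k)) `^ s)%:E)).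
- by apply: eq_integral => c _; rewrite prode_EFin.
- move=> k; apply/measurable_EFinP; apply: (measurableT_comp (measurable_powR s)).
  exact: measurable_channel_r hp _.
- by move=> k x; rewrite lee_fin powR_ge0.
Qed.

(** After exchanging the integrals, [rivals_bound] applies at each fixed output with [word_weight]
    as [V]. The resulting power of the mean is a product over letters, so its output integral is the
    [n]-th power of Gallager's integral. *)
Lemma integral_union_bound (P : probability X R) n (rho K : R) M (i : 'I_M) :
  (0 < rho <= 1)%R -> gallager_integral mu p rho P <= K%:E ->
  \int[code_ensemble P n M]_C \int[tuple_product mu n]_y (union_bound rho i C y)%:E <=
  (M.-1%:R `^ rho * K ^+ n)%:E.
Proof.
move=> r01 gK; have /andP[r0 r1] := r01.
have r10 : (0 < 1 + rho)%R by rewrite addr_gt0.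
have h0 y : 0 <= \int[P]_x ((p x y) `^ (1 + rho)^-1)%:E by exact: gallager_mean_ge0.
have mh : measurable_fun setT (fun y => \int[P]_x ((p x y) `^ (1 + rho)^-1)%:E).
  exact: measurable_gallager_mean hp _ _.
have mhk : measurable_fun setT (fun y => (\int[P]_x ((p x y) `^ (1 + rho)^-1)%:E) `^ (1 + rho)).
  exact: (measurableT_comp (measurable_poweR _)).
rewrite (fubini_tonelli (fun z => (union_bound rho i z.1 z.2)%:E)); last 2 first.
- apply/measurable_EFinP.
  by apply: (measurable_union_bound2 rho i (C := fst) (y := snd)).
- by move=> z; rewrite lee_fin union_bound_ge0.
have mprod : measurable_fun setT (fun y : n.-tuple Y =>
    \prod_(k < n) (\int[P]_x ((p x (tnth y k)) `^ (1 + rho)^-1)%:E) `^ (1 + rho)).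
  exact: (measurable_prod_tnth (fun=> mhk)).
apply: (@le_trans _ _ (\int[tuple_product mu n]_y ((M.-1%:R `^ rho)%:E *
    \prod_(k < n) (\int[P]_x ((p x (tnth y k)) `^ (1 + rho)^-1)%:E) `^ (1 + rho)))).
  apply: ge0_le_integral => //.
  - by move=> y _; apply: integral_ge0 => C _; rewrite lee_fin union_bound_ge0.
  - apply: (measurable_fun_fubini_tonelli_G (fun z => (union_bound rho i z.1 z.2)%:E)).
      apply/measurable_EFinP.
      by apply: (measurable_union_bound2 rho i (C := fst) (y := snd)).
    by move=> z; rewrite lee_fin union_bound_ge0.
  - by apply: emeasurable_funM => //; exact: measurable_cst.
  - move=> y _; rewrite -poweR_prod// -integral_word_weight.
    apply: rivals_bound => //.
    + by apply: tuple_productT; exact: probability_setT.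
    + by move=> c; exact: word_weight_ge0.
    + by apply: measurable_word_weight2 => //; exact: measurable_cst.
rewrite ge0_integralZl_EFin ?powR_ge0//; last first.
  by move=> y _; apply: prode_ge0 => k _; exact: poweR_ge0.
rewrite (@integral_tuple_prod _ _ _ mu n
  (fun=> fun y => (\int[P]_x ((p x y) `^ (1 + rho)^-1)%:E) `^ (1 + rho)))//; last first.
  by move=> _ y; exact: poweR_ge0.
rewrite EFinM lee_wpmul2l ?lee_fin ?powR_ge0//.
exact: prode_const_le (gallager_integral_ge0 _ _ _ _) gK.
Qed.

(** Ties are broken in favour of the least maximiser, so that each decision region is a measurable
    set minus a finite union of measurable sets. *)
Lemma max_decoder d (T : measurableType d) M (u : 'I_M.+1 -> T -> R) :
  (forall m, measurable_fun setT (u m)) ->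
  exists g : T -> 'I_M.+1, (forall m, measurable (g @^-1` [set m])) /\
    forall y m, (u m y <= u (g y) y)%R.
Proof.
move=> mu_; pose A m := [set y | forall j, (u j y <= u m y)%R].
have mA m : measurable (A m).
  rewrite (_ : A m = \bigcap_(j in [set: 'I_M.+1]) [set y | (u j y <= u m y)%R]).
    apply: fin_bigcap_measurable => // j _.
    by rewrite -[X in measurable X]setTI; exact: measurable_fun_le.
  by apply/seteqP; split=> y Ay j => [_|]; exact: Ay.
have Acover y : exists m, `[< A m y >].
  have [m _ Hm] := @arg_maxP _ _ _ ord0 xpredT (u^~ y) isT.
  by exists m; apply/asboolP => j; exact: Hm.
pose m0 y := xchoose (Acover y).
have m0P y : `[< A (m0 y) y >] by exact: (xchooseP (Acover y)).
pose g y := [arg min_(m < m0 y | `[< A m y >]) (m : nat)].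
exists g; split.
  move=> m; rewrite (_ : g @^-1` [set m] =
      A m `\` \bigcup_(j in [set j : 'I_M.+1 | (j < m)%N]) A j).
    apply: measurableD => //; apply: fin_bigcup_measurable => //.
  apply/seteqP; split=> y /=.
    rewrite /g; case: arg_minnP => // k /asboolP Ak kmin <-; split => // -[j /= jk Aj].
    by have := kmin j (asboolT Aj); rewrite leqNgt jk.
  rewrite /g; case: arg_minnP => // k /asboolP Ak kmin [Am nA].
  apply/val_inj/eqP; rewrite eqn_leq kmin ?asboolT//= leqNgt; apply/negP => km.
  by apply: nA; exists k.
move=> y m; rewrite /g; case: arg_minnP => // k /asboolP Ak _; exact: Ak.
Qed.

(** The decoder maximises [word_weight], hence the likelihood. When it errs, its choice is a rival
    weighing at least as much as the sent word, so the rival sum dominates the weight of the sent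
    word. *)
Lemma avg_error_union_bound n (rho : R) M (C : M.+1.-tuple (n.-tuple X)) :
  (0 < rho)%R -> exists g : n.-tuple Y -> 'I_M.+1, is_decoder g /\
    avg_error mu p C g <= (M.+1%:R^-1)%:E *
      \sum_(i < M.+1) \int[tuple_product mu n]_y (union_bound rho i C y)%:E.
Proof.
move=> r0; have [p0 _ _] := hp; have r10 : (0 < 1 + rho)%R by rewrite addr_gt0.
pose s := ((1 + rho)^-1)%R.
have mV i : measurable_fun setT (fun y : n.-tuple Y => word_weight s y (tnth C i)).
  by apply: measurable_word_weight2 => //; exact: measurable_cst.
have [g [mg gmax]] := max_decoder mV.
exists g; split=> //; rewrite /avg_error lee_wpmul2l ?lee_fin ?invr_ge0//.
apply: lee_sum => i _.
have mU : measurable_fun setT (fun y : n.-tuple Y => (union_bound rho i C y)%:E).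
  apply/measurable_EFinP.
  by apply: (measurable_union_bound2 rho i (C := fun=> C)) => //; exact: measurable_cst.
have mD : measurable [set y | g y <> i].
  rewrite (_ : [set y | _] = ~` (g @^-1` [set i])); first exact: measurableC.
  by apply/seteqP; split.
apply: (@le_trans _ _ (\int[tuple_product mu n]_(y in [set y | g y <> i])
    (union_bound rho i C y)%:E)); last first.
  by apply: ge0_subset_integral => // y _; rewrite lee_fin union_bound_ge0.
apply: ge0_le_integral => //.
- by move=> y _; apply: prode_ge0 => k _; rewrite lee_fin.
- apply: measurable_funTS; apply: (measurable_prod_tnth
    (f := fun k y => (p (tnth (tnth C i) k) y)%:E)) => k.
  by apply/measurable_EFinP; exact: measurable_channel_l hp _.
- exact: measurable_funTS.
move=> y /= /eqP gi; rewrite /memoryless prode_EFin lee_fin.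
set w := (\prod_(k < n) _)%R; have w0 : (0 <= w)%R by apply: prodr_ge0.
have wV : word_weight s y (tnth C i) = (w `^ s)%R by exact: word_weightE.
(* Splits the likelihood into the factor of the sent word in the union bound and the share that the
   rival sum dominates. *)
have -> : (w = w `^ s * (w `^ s) `^ rho)%R.
  have [->|wn0] := eqVneq w 0%R; first by rewrite powR0 ?mul0r// invr_eq0 gt_eqF.
  rewrite -powRrM -powRD ?(negbTE wn0) ?implybT//.
  rewrite (_ : s + s * rho = 1)%R ?powRr1//.
  by rewrite /s; field; rewrite gt_eqF.
rewrite /union_bound -/s wV; apply: ler_wpM2l; first exact: powR_ge0.
apply: ge0_ler_powR; rewrite ?nnegrE ?powR_ge0 ?(ltW r0)//.
  by apply: sumr_ge0 => j _; exact: word_weight_ge0.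
rewrite -wV; apply: le_trans (gmax y i) _.
rewrite big_enum/= (bigD1 (g y))//= lerDl; apply: sumr_ge0 => j _; exact: word_weight_ge0.
Qed.

(** A first-moment argument that also avoids a null set. If [B > e] held off [N], the excess [f]
    would have integral 0 and so vanish almost everywhere, although it is positive off a null set; a
    space of mass 1 would then be null. *)
Lemma exists_not_negligible_le d (T : measurableType d)
    (m : {measure set T -> \bar R}) (B : T -> \bar R) (e : R) (N : set T) :
  m setT = 1 -> measurable_fun setT B -> (forall x, 0 <= B x) -> (0 <= e)%R ->
  \int[m]_x B x <= e%:E -> m.-negligible N ->
  exists x, ~ N x /\ B x <= e%:E.
Proof.
move=> m1 mB B0 e0 Be [N0 [mN0 mN00 NN0]]; apply: contrapT => /forallNP H.
have HB x : ~ N0 x -> e%:E < B x.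
  move=> nN; rewrite ltNge; apply/negP => Bx.
  by apply: (H x); split => // /NN0.
(* Truncation keeps the excess nonnegative on the null set as well. *)
pose f x := maxe (B x - e%:E) 0.
have f0 x : 0 <= f x by rewrite le_max lexx orbT.
have mf : measurable_fun setT f.
  apply: measurable_maxe; last exact: measurable_cst.
  by apply: emeasurable_funB => //; exact: measurable_cst.
have BE : ae_eq m setT B (fun x => e%:E + f x).
  exists N0; split => // x /=; apply: contra_notP => nN _.
  by rewrite /f max_l ?sube_ge0 ?(ltW (HB _ nN))// addeC subeK.
have If : \int[m]_x f x = 0.
  have : e%:E + \int[m]_x f x <= e%:E.
    apply: le_trans Be; rewrite (ge0_ae_eq_integral _ _ _ _ _ BE)//; last 2 first.
    - by apply: emeasurable_funD => //; exact: measurable_cst.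
    - by move=> x _; rewrite adde_ge0// lee_fin.
    have -> : \int[m]_x (e%:E + f x) = \int[m]_x e%:E + \int[m]_x f x.
      by rewrite ge0_integralD.
    have -> : \int[m]_x e%:E = e%:E.
      by rewrite -[RHS]mule1 -m1; exact: (integral_cst m measurableT e%:E).
    by [].
  rewrite -[leRHS]adde0 leeD2lE// => If; apply/eqP; rewrite eq_le If.
  by apply: integral_ge0 => x _.
have : ae_eq m setT f (cst 0).
  apply/(ae_eq_integral_abs _ measurableT mf); rewrite -[RHS]If.
  by apply: eq_integral => x _; rewrite gee0_abs.
move=> [A [mA A0 fA]].
have : m setT <= m (N0 `|` A).
  rewrite le_measure ?inE//; first exact: measurableU.
  move=> x _; have [xN|xN] := pselect (N0 x); [by left|right].
  apply: fA => /=; move/(_ I); rewrite /f => fx.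
  have := HB x xN; rewrite ltNge => /negP; apply.
  by rewrite -sube_le0 -fx le_max lexx.
by rewrite m1 (null_set_setU mN0 mA mN00 A0) lee_fin ler10.
Qed.

(** Each of the [M.+1] code words has [M] rivals, which is why [M] and not the code size enters the
    error bound. [exists_not_negligible_le] is applied to the message average of the union
    bounds. *)
Theorem random_coding (P : probability X R) n M (rho K e : R) :
  (0 < rho <= 1)%R -> gallager_integral mu p rho P <= K%:E ->
  (M%:R `^ rho * K ^+ n <= e)%R ->
  forall N : set (M.+1.-tuple (n.-tuple X)),
    (code_ensemble P n M.+1).-negligible N ->
    exists C : M.+1.-tuple (n.-tuple X), ~ N C /\
      exists g : n.-tuple Y -> 'I_M.+1,
        is_decoder g /\ avg_error mu p C g <= e%:E.
Proof.
move=> r01 gK Me N hN; have /andP[r0 _] := r01.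
pose B (C : M.+1.-tuple (n.-tuple X)) := (M.+1%:R^-1)%:E *
  \sum_(i < M.+1) \int[tuple_product mu n]_y (union_bound rho i C y)%:E.
have U0 i (C : M.+1.-tuple (n.-tuple X)) :
    0 <= \int[tuple_product mu n]_y (union_bound rho i C y)%:E.
  by apply: integral_ge0 => y _; rewrite lee_fin union_bound_ge0.
have mU i : measurable_fun setT (fun C : M.+1.-tuple (n.-tuple X) =>
    \int[tuple_product mu n]_y (union_bound rho i C y)%:E).
  apply: (measurable_fun_fubini_tonelli_F (fun z => (union_bound rho i z.1 z.2)%:E)).
    apply/measurable_EFinP.
    by apply: (measurable_union_bound2 rho i (C := fst) (y := snd)).
  by move=> z; rewrite lee_fin union_bound_ge0.
have mS : measurable_fun setT (fun C : M.+1.-tuple (n.-tuple X) =>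
    \sum_(i < M.+1) \int[tuple_product mu n]_y (union_bound rho i C y)%:E).
  exact: emeasurable_sum.
have Mi : (0 <= M.+1%:R^-1 :> R)%R by rewrite invr_ge0.
have e0 : (0 <= e)%R.
  apply: le_trans Me; rewrite mulr_ge0 ?powR_ge0// exprn_ge0// -lee_fin.
  by apply: le_trans gK; exact: gallager_integral_ge0.
have m1 : code_ensemble P n M.+1 setT = 1.
  by do 2 apply: tuple_productT; exact: probability_setT.
have [C [nNC BC]] : exists C, ~ N C /\ B C <= e%:E.
  apply: (exists_not_negligible_le m1 _ _ e0 _ hN).
  - by apply: emeasurable_funM => //; exact: measurable_cst.
  - by move=> C; rewrite mule_ge0 ?lee_fin// sume_ge0.
  - rewrite ge0_integralZl_EFin//; last by move=> C _; exact: sume_ge0.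
    rewrite ge0_integral_sum//.
    apply: (@le_trans _ _ ((M.+1%:R^-1)%:E * \sum_(i < M.+1) e%:E)).
      rewrite lee_wpmul2l ?lee_fin//; apply: lee_sum => i _.
      by apply: le_trans (integral_union_bound n i r01 gK) _; rewrite lee_fin.
    rewrite sumEFin -EFinM lee_fin sumr_const card_ord -[(e *+ _)%R]mulr_natl.
    by rewrite mulrA mulVf ?mul1r// pnatr_eq0.
exists C; split => //; have [g [dg gB]] := avg_error_union_bound C r0.
by exists g; split => //; exact: le_trans gB BC.
Qed.

End random_coding.

(** * Rates *)

Section sparsity_arith.
Context (R : realType).
Implicit Types (n : nat) (e chi : R).

Lemma xi_gt0 e : 0 < xi e. Proof. exact: expR_gt0. Qed.

Lemma sparsity_gt0 n e chi : (0 < n)%N -> 0 < e -> 0 < chi ->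
  0 < sparsity n e chi.
Proof.
move=> n0 e0 c0; rewrite divr_gt0 ?sqrtr_gt0 ?mulr_gt0 ?xi_gt0 ?ltr0n//.
Qed.

Lemma sparsity_detection n e chi : (0 < n)%N -> 0 < e -> 0 < chi ->
  (1 + sparsity n e chi ^+ 2 * chi) ^+ n <= 1 + 4 * e ^+ 2.
Proof.
move=> n0 e0 c0; have nR : 0 < n%:R :> R by rewrite ltr0n.
have [w0 wE] : 0 < lambertW0 (4 * e ^+ 2) /\
    lambertW0 (4 * e ^+ 2) * expR (lambertW0 (4 * e ^+ 2)) = 4 * e ^+ 2.
  by apply: lambertW0P; rewrite mulr_gt0 ?exprn_gt0.
set w := lambertW0 _ in w0 wE.
have xi2 : xi e ^+ 2 = expR (- w).
  by rewrite /xi -/w -expRM_natl; congr expR; field.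
have -> : sparsity n e chi ^+ 2 * chi = w / n%:R.
  rewrite /sparsity expr_div_n sqr_sqrtr ?mulr_ge0 ?ltW// !exprMn xi2.
  (* As [xi e] has square [e^(- w)], the Lambert equation turns [4 e^2 xi^2] into [w]. *)
  have : w = 4 * e ^+ 2 * expR (- w) by rewrite -wE -mulrA -expRD addrN expR0 mulr1.
  by set q := expR _ => ->; field; rewrite !gt_eqF.
have wn : 0 <= w / n%:R by rewrite divr_ge0 ?ltW.
apply: (@le_trans _ _ (expR (w / n%:R) ^+ n)).
  by rewrite lerXn2r ?nnegrE ?addr_ge0 ?expR_ge0// expR_ge1Dx.
have -> : expR (w / n%:R) ^+ n = expR w.
  by rewrite -expRM_natl; congr expR; field; rewrite gt_eqF.
(* The remaining [e^w - 1 <= w e^w], divided by [e^w], is [1 - w <= e^(- w)]. *)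
rewrite -wE -lerBlDr.
rewrite -[X in X - _]mul1r -mulrBl -ler_pdivlMr ?expR_gt0// div1r -expRN.
exact: expR_ge1Dx.
Qed.

(** [n * sparsity n e chi], the mean number of letters drawn from the kernel, equals
    [2 xi e sqrt n / sqrt chi]: hence the growth in [sqrt n] of the claimed rate. *)
Lemma sparsity_rate n e chi E0 rho d : (0 < n)%N -> 0 < chi -> 0 < rho ->
  e * Num.sqrt n%:R * Lrate e E0 chi rho + rho^-1 * log2 d =
  (n%:R * sparsity n e chi * (1 - expR (- (1 + rho)^-1 * E0)) * (1 + rho) + ln d)
    / rho / ln 2.
Proof.
move=> n0 c0 r0; have nR : 0 < n%:R :> R by rewrite ltr0n.
have l2 : 0 < ln 2 :> R by rewrite ln_gt0// ltr1n.
rewrite /Lrate /log2 /sparsity sqrtrM ?ltW//.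
have sn : n%:R = Num.sqrt n%:R ^+ 2 :> R by rewrite sqr_sqrtr// ltW.
set q := expR _; rewrite [in RHS]sn sqrtr_sqr ger0_norm ?sqrtr_ge0//.
by field; rewrite !gt_eqF ?sqrtr_gt0.
Qed.

End sparsity_arith.

(** * Boundedness of the rates, and the error at a given rate *)

Section rate.
Context (R : realType).

Lemma rate_bounded (kappa : R -> R) (A d : R) :
  0 < A -> 0 < d < 1 -> (forall rho, kappa rho <= 1) ->
  (forall e, 0 < e -> exists N : nat,
    forall rho, 0 < rho <= N.+1%:R^-1 -> kappa rho <= e) ->
  exists m : nat, forall rho, 0 < rho <= 1 ->
    expR ((A * kappa rho * (1 + rho) + ln d) / rho) <= m%:R.
Proof.
move=> A0 /andP[d0 d1] k1 k0; have lnd : ln d < 0 by rewrite ln_lt0// d0.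
(* This threshold makes [A kappa (1 + rho)] at most [- ln d] for [rho] near 0, so that the exponent
   is at most 0 there; elsewhere [1 / rho < N.+1] bounds it by [2 A N.+1]. *)
have [|N HN] := k0 (- ln d / (2 * A)).
  by rewrite divr_gt0 ?oppr_gt0 ?mulr_gt0.
set B := expR (2 * A * N.+1%:R); exists (Num.bound B) => rho /andP[r0 r1].
apply: le_trans (ltW (archi_boundP (expR_ge0 _))); rewrite ler_expR ler_pdivrMr//.
have [rN|rN] := leP rho N.+1%:R^-1.
  have kr : kappa rho <= - ln d / (2 * A) by apply: HN; rewrite r0.
  apply: (@le_trans _ _ 0); last by rewrite !mulr_ge0 ?ltW.
  have [k00|k00] := leP (kappa rho) 0.
    have : A * kappa rho * (1 + rho) <= 0.
      by apply: mulr_le0_ge0; [apply: mulr_ge0_le0|]; lra.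
    by lra.
  have : A * kappa rho * (1 + rho) <= A * (- ln d / (2 * A)) * 2.
    by apply: ler_pM; [rewrite mulr_ge0 ?ltW|lra|rewrite ler_pM2l|lra].
  have -> : A * (- ln d / (2 * A)) * 2 = - ln d by field; rewrite gt_eqF.
  by lra.
have rN1 : 1 <= N.+1%:R * rho by rewrite -ler_pdivrMl// mulr1 ltW.
have : A * kappa rho * (1 + rho) <= 2 * A.
  have [k00|k00] := leP (kappa rho) 0.
    apply: (@le_trans _ _ 0); last by rewrite mulr_ge0 ?ltW.
    by apply: mulr_le0_ge0; [apply: mulr_ge0_le0|]; lra.
  rewrite [2 * A]mulrC.
  by apply: ler_pM; [rewrite mulr_ge0 ?ltW|lra|rewrite ger_pMr|lra].
have : 2 * A <= 2 * A * (N.+1%:R * rho) by rewrite ler_pMr// mulr_gt0.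
by lra.
Qed.

(** By [1 - t k <= e^(- t k)], the [n]-th power is at most [e^(- n t k (1 + rho))], which reduces
    the bound on the [rho]-th power of [M] to [d]. *)
Lemma decoding_error_le (n M : nat) (rho t k d : R) :
  0 < rho -> 0 <= t <= 1 -> k <= 1 -> 0 < d ->
  M%:R <= expR ((n%:R * t * k * (1 + rho) + ln d) / rho) ->
  M%:R `^ rho * ((1 - t * k) `^ (1 + rho)) ^+ n <= d.
Proof.
move=> r0 /andP[t0 t1] k1 d0 HM.
have tk : 0 <= 1 - t * k.
  rewrite subr_ge0; apply: le_trans t1; rewrite -[leRHS]mulr1; exact: ler_wpM2l.
apply: (@le_trans _ _ (expR (n%:R * t * k * (1 + rho) + ln d) *
   expR (- (t * k) * (1 + rho)) ^+ n)).
  apply: ler_pM; rewrite ?powR_ge0 ?exprn_ge0 ?powR_ge0//.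
    have -> : expR (n%:R * t * k * (1 + rho) + ln d) =
        expR ((n%:R * t * k * (1 + rho) + ln d) / rho) `^ rho.
      by rewrite -expRM divfK ?gt_eqF.
    by apply: ge0_ler_powR; rewrite ?nnegrE ?expR_ge0 ?(ltW r0).
  apply: lerXn2r; rewrite ?nnegrE ?powR_ge0 ?expR_ge0//.
  rewrite expRM; apply: ge0_ler_powR;
    by rewrite ?nnegrE ?expR_ge0 ?expR_ge1Dx ?tk ?addr_ge0 ?(ltW r0).
rewrite -expRM_natl -expRD.
rewrite (_ : _ + _ = ln d); last by ring.
by rewrite lnK.
Qed.

End rate.

(** * One code size for every [rho], and the conclusion *)

Theorem theorem2 (R : realType) (dX dY dW : measure_display)
    (X : measurableType dX) (Y : measurableType dY) (W : measurableType dW)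
    (muY : {sigma_finite_measure set Y -> \bar R})
    (muW : {sigma_finite_measure set W -> \bar R})
    (pYX : X -> Y -> R) (pWX : X -> W -> R)
    (hpYX : channel_density muY pYX) (hpWX : channel_density muW pWX)
    (x0 : X) (PXt PX : probability X R)
    (n : nat) (eps_det eps_dec : R) :
  let pWx0 := fun w => (pWX x0 w)%:E in
  let pYx0 := fun y => (pYX x0 y)%:E in
  let pW := output_density PX pWX in
  let pY := output_density PX pYX in
  let chi := chi2 muW (output_density PXt pWX) pWx0 in
  let tau := sparsity n eps_det (fine chi) in
  let L := fun rho =>
    Lrate eps_det (gallager_E0 muY rho PXt pYX) (fine chi) rho in
  (0 < n)%N ->
  0 < eps_det < 1 ->
  0 < eps_dec < 1 ->
  (0 < chi < +oo)%E ->
  0 <= tau <= 1 ->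
  sparse_signalling x0 tau PXt PX ->
  dominated muW pW pWx0 ->
  dominated muY pY pYx0 ->
  exists M : nat,
    [/\ (0 < M)%N,
        (* "a code from the ensemble": not in any given null set of codes *)
        forall N : set (M.-tuple (n.-tuple X)),
          (code_ensemble PX n M).-negligible N ->
          exists C : M.-tuple (n.-tuple X),
            ~ N C /\
            exists g : n.-tuple Y -> 'I_M,
              is_decoder g /\ (avg_error muY pYX C g <= eps_dec%:E)%E,
        detection_prob_le muW n pWx0 pW eps_det &
        forall rho : R, 0 < rho <= 1 ->
          eps_det * Num.sqrt n%:R * L rho + rho^-1 * log2 eps_dec
            <= log2 M%:R].
Proof.
move=> pWx0 pYx0 pW pY chi tau L n0 /andP[e0 _] d01 chi_fin t01 hP _ _.
have /andP[d0 _] := d01; have nR : 0 < n%:R :> R by rewrite ltr0n.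
have chiE : chi = (fine chi)%:E.
  by rewrite fineK// fin_real//; case/andP: chi_fin => /(lt_trans (ltNyr 0)) ->.
have chi0 : 0 < fine chi by rewrite -lte_fin -chiE; case/andP: chi_fin.
have tau0 : 0 < tau by exact: sparsity_gt0.
have tau01 : 0 < tau <= 1 by rewrite tau0; case/andP: t01.
pose kappa rho := 1 - exponent_ratio muY pYX rho PXt.
(* The claimed lower bound multiplied by [ln 2], that is in nats. *)
pose rate rho := (n%:R * tau * kappa rho * (1 + rho) + ln eps_dec) / rho.
have kappa1 rho : kappa rho <= 1 by rewrite gerBl expR_ge0.
have [m Hm] : exists m : nat, forall rho, 0 < rho <= 1 -> expR (rate rho) <= m%:R.
  apply: rate_bounded => //; first by rewrite mulr_gt0.
  by move=> e; exact: exponent_ratio_near0 hpYX PXt _.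
pose above m := `[< forall rho, 0 < rho <= 1 -> expR (rate rho) <= m%:R >].
have exm : exists m, above m by exists m; exact/asboolP.
(* The least dominating size is nonzero, as exponentials are positive, and is written [M.+1]. *)
case: (ex_minnP exm) => -[|M] /asboolP HM Mmin.
  by have := HM 1; rewrite ltr01 lexx leNgt expR_gt0 => /(_ isT).
(* By minimality [M] fails to dominate some rate. The decoding error is controlled at this [rho]
   alone, while the lower bound on the code size holds for all of them. *)
have [rho r01 Mrho] : exists2 rho, 0 < rho <= 1 & M%:R < expR (rate rho).
  apply: contrapT => H; have := Mmin M; rewrite ltnn => /(_ _)/negP; apply => //.
  apply/asboolP => rho r01; rewrite leNgt; apply/negP => Mr; apply: H.
  by exists rho.
have /andP[r0 _] := r01.
exists M.+1; split => //.
- apply: (random_coding hpYX r01 (gallager_integral_sparse hpYX r0 tau01 hP)).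
  exact: decoding_error_le (ltW Mrho).
- have p0 := (let: And3 p0 _ _ := hpWX in p0).
  have p1 := (let: And3 _ _ p1 := hpWX in p1).
  apply: (detection_prob_le_chi2 (k := 1 + tau ^+ 2 * fine chi)) => //.
  + by move=> w; exact: output_density_ge0 hpWX _ _.
  + exact: measurable_channel_l hpWX _.
  + exact: measurable_output_density hpWX _.
  + exact: integral_output_density hpWX _.
  + by rewrite (integral_chi2_sparse hpWX tau01 hP) -/pWx0 -/chi chiE.
  + exact: sparsity_detection.
- move=> r r1; have /andP[rgt0 _] := r1.
  rewrite sparsity_rate// -/tau -/(rate r) /log2 ler_pM2r ?invr_gt0 ?ln_gt0 ?ltr1n//.
  by rewrite -ler_expR lnK ?posrE ?ltr0Sn// HM.
Qed.
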